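(* Assume Assumption A1(2) and Assumption A2 (see context). Let $(\eta_s)_{s\ge 1}$ be a nonincreasing sequence of step sizes with $0<\eta_s\le \eta_{\infty,2}$ for all $s$, and let $(H_s)_{s\ge1}$ be a nondecreasing sequence of positive integers. Then for every $t\ge 1$ the FedLSA iterate $\theta_t$ satisfies \[ \mathbb{E}^{1/2}\big[\|\theta_t-\theta_\star\|^2\big]\le \prod_{s=1}^t(1-\eta_s a)^{H_s}\|\theta_0-\theta_\star\| + \zeta_1\zeta_2\sum_{s=1}^t\eta_s^2H_s^2\exp\Big(-a\sum_{i=s+1}^t\eta_iH_i\Big) +\frac{\bar\sigma_\varepsilon+2\bar\sigma_{\mathrm{het}}}{\sqrt N}\sqrt{\sum_{s=1}^t\eta_s^2H_s\exp\Big(-2a\sum_{r=s+1}^t\eta_rH_r\Big)} +\sqrt{\frac{4\bar\sigma_{\mathbf A}^2\zeta_1^2\zeta_2^2}{N a e}}\sqrt{\sum_{s=1}^t\eta_s^5H_s^4\exp\Big(-a\sum_{r=s+1}^t\eta_rH_r\Big)}. \]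
   Context: Setting (federated linear stochastic approximation). Fix integers $N\ge1$ (number of agents) and $d\ge1$. For each agent $c\in\{1,\dots,N\}$ there is a probability distribution $\pi_c$ on a measurable space $(\mathsf Z,\mathcal Z)$ and measurable maps $z\mapsto \mathbf A^c(z)\in\mathbb R^{d\times d}$, $z\mapsto \mathbf b^c(z)\in\mathbb R^d$; set $\bar{\mathbf A}^c=\mathbb E_{Z\sim\pi_c}[\mathbf A^c(Z)]$, $\bar{\mathbf b}^c=\mathbb E_{Z\sim\pi_c}[\mathbf b^c(Z)]$, $\bar{\mathbf A}=N^{-1}\sum_c\bar{\mathbf A}^c$, $\bar{\mathbf b}=N^{-1}\sum_c\bar{\mathbf b}^c$. Let $\theta_\star$ solve $\bar{\mathbf A}\theta_\star=\bar{\mathbf b}$ and $\theta_\star^c$ solve $\bar{\mathbf A}^c\theta^c_\star=\bar{\mathbf b}^c$. Write $\tilde{\mathbf A}^c(z)=\mathbf A^c(z)-\bar{\mathbf A}^c$, $\tilde{\mathbf b}^c(z)=\mathbf b^c(z)-\bar{\mathbf b}^c$, $\varepsilon^c(z)=\tilde{\mathbf A}^c(z)\theta^c_\star-\tilde{\mathbf b}^c(z)$. Norms are Euclidean / operator norms. Assumption A1(p) ($p\ge1$): for each $c$, $-\bar{\mathbf A}^c$ is Hurwitz, and there are constants $a>0$, $\eta_{\infty,p}>0$ with $\eta_{\infty,p}a\le 1/2$ such that for all $0<\eta<\eta_{\infty,p}$ and $u\in\mathbb R^d$, $\mathbb E^{1/p}_{Z\sim\pi_c}[\|(I-\eta\mathbf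 A^c(Z))u\|^p]\le(1-\eta a)\|u\|$. Assumption A2: all samples $Z^c_{t,h}$ ($t\ge1$, $1\le h\le H_t$, $c\in[N]$) are independent with $Z^c_{t,h}\sim\pi_c$; moreover $\|\varepsilon\|_\infty:=\max_c\sup_z\|\varepsilon^c(z)\|<\infty$ and $C_A:=\max_c\sup_z\max(\|\mathbf A^c(z)\|,\|\tilde{\mathbf A}^c(z)\|)<\infty$. FedLSA: given step sizes $\eta_t>0$, local step numbers $H_t\in\mathbb N$ and $\theta_0\in\mathbb R^d$, for $t\ge1$ each agent sets $\theta^c_{t,0}=\theta_{t-1}$, $\theta^c_{t,h}=\theta^c_{t,h-1}-\eta_t(\mathbf A^c(Z^c_{t,h})\theta^c_{t,h-1}-\mathbf b^c(Z^c_{t,h}))$ for $h=1,\dots,H_t$, and $\theta_t=N^{-1}\sum_{c=1}^N\theta^c_{t,H_t}$. Heterogeneity and variance quantities: $\zeta_1^2=N^{-1}\sum_c\|\bar{\mathbf A}^c(\theta^c_\star-\theta_\star)\|^2$, $\zeta_2^2=N^{-1}\sum_c\|\bar{\mathbf A}^c-\bar{\mathbf A}\|^2$; $\Sigma^c_{\mathbf A}=\mathbb E_{Z\sim\pi_c}[\tilde{\mathbf A}^c(Z)^\top\tilde{\mathbf A}^c(Z)]$, $\Sigma^c_\varepsilon=\mathbb E_{Z\sim\pi_c}[\varepsilon^c(Z)\varepsilon^c(Z)^\top]$; $\bar\sigma_\varepsilon^2=N^{-1}\sum_c\mathrm{Tr}(\Sigma_\varepsilon^c)$, $\bar\sigma_{\mathrm{het}}^2=N^{-1}\sum_c\|\Sigma^c_{\mathbf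 A}\|\,\|\theta^c_\star-\theta_\star\|^2$, $\bar\sigma_{\mathbf A}^2=N^{-1}\sum_c\|\Sigma_{\mathbf A}^c\|^2$. *)

(* Defs.v *)
From HB Require Import structures.
From mathcomp Require Import all_boot all_order all_algebra.
From mathcomp Require Import all_classical all_reals all_analysis.
From mathcomp Require Import complex.

Set Implicit Arguments.
Unset Strict Implicit.
Unset Printing Implicit Defensive.

Import Order.TTheory GRing.Theory Num.Theory.
Local Open Scope classical_set_scope.
Local Open Scope ring_scope.

Definition enorm {R : realType} {d : nat} (v : 'cV[R]_d) : R :=
  Num.sqrt (\sum_(i < d) v i 0 ^+ 2).

Definition opnorm {R : realType} {d : nat} (M : 'M[R]_d) : R :=
  sup [set enorm (M *m u) | u in [set u : 'cV[R]_d | enorm u <= 1]].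

Definition hurwitz {R : realType} {d : nat} (M : 'M[R]_d) : Prop :=
  forall lam : R[i],
    eigenvalue (map_mx (fun x : R => Complex x 0) M) lam -> complex.Re lam < 0.

Definition mean_mx {R : realType} {dZ} {Z : measurableType dZ}
  (pi : probability Z R) {m n : nat} (F : Z -> 'M[R]_(m, n)) : 'M[R]_(m, n) :=
  \matrix_(i, j) Rintegral pi setT (fun z => F z i j).

Definition mutually_independent {R : realType} {dO dZ}
  {Omega : measurableType dO} {Z : measurableType dZ} (P : probability Omega R)
  {I : eqType} (Idx : set I) (X : I -> Omega -> Z) : Prop :=
  forall (s : seq I) (B : I -> set Z),
    uniq s -> (forall i, i \in s -> Idx i) -> (forall i, measurable (B i)) ->
    P (\bigcap_(i in [set` s]) (X i @^-1` B i)) =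
    (\prod_(i <- s) P (X i @^-1` B i))%E.

Fixpoint local_iter {R : realType} {d : nat} {Z : Type}
  (eta : R) (A : Z -> 'M[R]_d) (b : Z -> 'cV[R]_d) (Zs : nat -> Z)
  (theta : 'cV[R]_d) (h : nat) : 'cV[R]_d :=
  match h with
  | 0 => theta
  | h'.+1 =>
      let th := local_iter eta A b Zs theta h' in
      th - eta *: (A (Zs h'.+1) *m th - b (Zs h'.+1))
  end.

Fixpoint fedlsa {R : realType} {d N : nat} {Z Omega : Type}
  (A : 'I_N -> Z -> 'M[R]_d) (b : 'I_N -> Z -> 'cV[R]_d)
  (eta : nat -> R) (H : nat -> nat) (theta0 : 'cV[R]_d)
  (Zs : 'I_N -> nat -> nat -> Omega -> Z) (omega : Omega) (t : nat)
  : 'cV[R]_d :=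
  match t with
  | 0 => theta0
  | t'.+1 =>
      (N%:R)^-1 *: \sum_(c < N)
         local_iter (eta t'.+1) (A c) (b c) (fun h => Zs c t'.+1 h omega)
           (fedlsa A b eta H theta0 Zs omega t') (H t'.+1)
  end.

(* Derived quantities of the federated problem.  pi c = pi_c, A c = A^c,
   b c = b^c, thc c = theta^c_star, ths = theta_star. *)
Section Quantities.
Context {R : realType} {dZ : measure_display} {Z : measurableType dZ}
  {N d : nat} (pi : 'I_N -> probability Z R)
  (A : 'I_N -> Z -> 'M[R]_d) (b : 'I_N -> Z -> 'cV[R]_d).

Definition Abar_c (c : 'I_N) : 'M[R]_d := mean_mx (pi c) (A c).
Definition bbar_c (c : 'I_N) : 'cV[R]_d := mean_mx (pi c) (b c).
Definition Abar : 'M[R]_d := (N%:R)^-1 *: \sum_(c < N) Abar_c c.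
Definition bbar : 'cV[R]_d := (N%:R)^-1 *: \sum_(c < N) bbar_c c.
Definition Atil (c : 'I_N) (z : Z) : 'M[R]_d := A c z - Abar_c c.
Definition btil (c : 'I_N) (z : Z) : 'cV[R]_d := b c z - bbar_c c.

Variables (thc : 'I_N -> 'cV[R]_d) (ths : 'cV[R]_d).

Definition epsf (c : 'I_N) (z : Z) : 'cV[R]_d := Atil c z *m thc c - btil c z.

Definition zeta1 : R :=
  Num.sqrt ((N%:R)^-1 * \sum_(c < N) enorm (Abar_c c *m (thc c - ths)) ^+ 2).
Definition zeta2 : R :=
  Num.sqrt ((N%:R)^-1 * \sum_(c < N) opnorm (Abar_c c - Abar) ^+ 2).

Definition SigmaA (c : 'I_N) : 'M[R]_d :=
  mean_mx (pi c) (fun z => (Atil c z)^T *m Atil c z).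
Definition Sigmaeps (c : 'I_N) : 'M[R]_d :=
  mean_mx (pi c) (fun z => epsf c z *m (epsf c z)^T).

Definition sigma_eps : R :=
  Num.sqrt ((N%:R)^-1 * \sum_(c < N) \tr (Sigmaeps c)).
Definition sigma_het : R :=
  Num.sqrt ((N%:R)^-1 * \sum_(c < N) opnorm (SigmaA c) * enorm (thc c - ths) ^+ 2).
Definition sigma_A : R :=
  Num.sqrt ((N%:R)^-1 * \sum_(c < N) opnorm (SigmaA c) ^+ 2).
End Quantities.

(* Main.v *)
Require Import Defs.
From HB Require Import structures.
From mathcomp Require Import all_boot all_order all_algebra.
From mathcomp Require Import all_classical all_reals all_analysis.
From mathcomp Require Import measurable_realfun complex ring lra.

Import Order.TTheory GRing.Theory Num.Theory.
Import numFieldNormedType.Exports HBSimple.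
Local Open Scope classical_set_scope.
Local Open Scope ring_scope.

Set Implicit Arguments.
Unset Strict Implicit.

(** Over one round, the error [theta^c_h - ths] of agent [c] is the sum of
    [Gamma_h (theta_(t-1) - ths)], where [Gamma_h] is a product of random
    contractions, of a deterministic bias, and of a centred fluctuation. After
    averaging over the agents, the biases cancel to first order, because
    [\sum_c Abar_c (thc c - ths) = 0], and only [eta^2 H^2 zeta1 zeta2] is left;
    the fluctuations are independent across agents, which yields the factor
    [1 / N]. Across rounds, the fluctuations are centred and independent of
    everything else, so their contributions are orthogonal in L2 and add up in
    squares, while the biases add up by Minkowski's inequality. This gives the
    bound with [sigma_eps + sigma_het] and without its last summand.

    All variables are bounded, since [b = A thc - eps], and independence is only
    used through the algebra spanned by the products of functions of single
    samples: on it [E(X Y) = E X * E Y] whenever [X] and [Y] involve disjoint sets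
    of samples. *)

(** * Bounded random variables *)

(** The bound holds everywhere, not only almost everywhere. The class is therefore closed under sums
    and products and integrable under every probability, so integrability side conditions reduce to
    closure properties. *)
Definition bmf {R : realType} {dT} {T : measurableType dT} (X : T -> R) : Prop :=
  measurable_fun setT X /\ exists M, forall x, `|X x| <= M.

Section BoundedFunctions.
Context {R : realType} {dT : measure_display} {T : measurableType dT}.
Implicit Types X Y : T -> R.

Lemma bmf_cst (k : R) : bmf (fun _ : T => k).
Proof. by split; [exact: measurable_cst | exists `|k|]. Qed.

Lemma bmfD X Y : bmf X -> bmf Y -> bmf (fun x => X x + Y x).
Proof.
move=> [mX [M XM]] [mY [L YL]]; split; first exact: measurable_funD.
by exists (M + L) => x; apply: le_trans (ler_normD _ _) (lerD _ _).
Qed.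

Lemma bmfM X Y : bmf X -> bmf Y -> bmf (fun x => X x * Y x).
Proof.
move=> [mX [M XM]] [mY [L YL]]; split; first exact: measurable_funM.
by exists (M * L) => x; rewrite normrM ler_pM.
Qed.

Lemma bmfZ k X : bmf X -> bmf (fun x => k * X x).
Proof. by move=> bX; apply: bmfM => //; exact: bmf_cst. Qed.

Lemma bmfB X Y : bmf X -> bmf Y -> bmf (fun x => X x - Y x).
Proof.
move=> bX bY; under eq_fun do rewrite -[- _]mulN1r.
by apply: bmfD => //; exact: bmfZ.
Qed.

Lemma bmf_sum (I : Type) (s : seq I) (F : I -> T -> R) :
  (forall i, bmf (F i)) -> bmf (fun x => \sum_(i <- s) F i x).
Proof.
move=> bF; elim: s => [|i s IH].
  by under eq_fun do rewrite big_nil; exact: bmf_cst.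
by under eq_fun do rewrite big_cons; exact: bmfD.
Qed.

Lemma bmf_prod (I : Type) (s : seq I) (F : I -> T -> R) :
  (forall i, bmf (F i)) -> bmf (fun x => \prod_(i <- s) F i x).
Proof.
move=> bF; elim: s => [|i s IH].
  by under eq_fun do rewrite big_nil; exact: bmf_cst.
by under eq_fun do rewrite big_cons; exact: bmfM.
Qed.

Lemma bmf_indic (B : set T) : measurable B -> bmf (\1_B : T -> R).
Proof.
move=> mB; split; first exact: measurable_indic.
by exists 1 => x; rewrite indicE; case: (_ \in _); rewrite ?normr1 ?normr0.
Qed.

Variable P : probability T R.

Lemma bmf_integrable X : bmf X -> P.-integrable setT (EFin \o X).
Proof.
move=> [mX [M XM]]; apply: measurable_bounded_integrable => //.
  by rewrite [X in (X < _)%E](probability_setT P) ltry.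
exists M; split; first exact: num_real.
by move=> y My x _ /=; apply: le_trans (XM x) (ltW My).
Qed.

Definition Ex (X : T -> R) : R := Rintegral P setT X.

Lemma Ex_cst k : Ex (fun=> k) = k.
Proof.
rewrite /Ex Rintegral_cst//.
by rewrite [X in fine X](probability_setT P) mulr1.
Qed.

Lemma ExD X Y : bmf X -> bmf Y -> Ex (fun x => X x + Y x) = Ex X + Ex Y.
Proof. by move=> bX bY; apply: RintegralD => //; exact: bmf_integrable. Qed.

Lemma ExZ k X : bmf X -> Ex (fun x => k * X x) = k * Ex X.
Proof. by move=> bX; apply: RintegralZl => //; exact: bmf_integrable. Qed.

Lemma ExB X Y : bmf X -> bmf Y -> Ex (fun x => X x - Y x) = Ex X - Ex Y.
Proof. by move=> bX bY; apply: RintegralB => //; exact: bmf_integrable. Qed.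

Lemma Ex_sum (I : Type) (s : seq I) (F : I -> T -> R) :
  (forall i, bmf (F i)) ->
  Ex (fun x => \sum_(i <- s) F i x) = \sum_(i <- s) Ex (F i).
Proof.
move=> bF; elim: s => [|i s IH].
  by rewrite big_nil; under eq_fun do rewrite big_nil; exact: Ex_cst.
rewrite big_cons -IH; under eq_fun do rewrite big_cons.
by rewrite ExD//; exact: bmf_sum.
Qed.

Lemma Ex_ge0 X : (forall x, 0 <= X x) -> 0 <= Ex X.
Proof. by move=> X0; exact: Rintegral_ge0. Qed.

Lemma le_Ex X Y : bmf X -> bmf Y -> (forall x, X x <= Y x) -> Ex X <= Ex Y.
Proof.
by move=> bX bY XY; apply: le_Rintegral => //; exact: bmf_integrable.
Qed.

Lemma Ex_indic (B : set T) : measurable B -> (Ex \1_B)%:E = P B.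
Proof.
move=> mB; rewrite /Ex /Rintegral integral_indic// setIT fineK//.
by rewrite fin_num_measure.
Qed.

Lemma le_norm_Ex X : bmf X -> `|Ex X| <= Ex (fun x => `|X x|).
Proof. by move=> bX; apply: le_normr_Rintegral => //; exact: bmf_integrable. Qed.

Lemma bmf_norm X : bmf X -> bmf (fun x => `|X x|).
Proof.
move=> [mX [M XM]]; split; first exact: measurableT_comp.
by exists M => x; rewrite normr_id.
Qed.

End BoundedFunctions.

Lemma bmf_comp {R : realType} {d1 d2} {T1 : measurableType d1}
  {T2 : measurableType d2} (h : T1 -> T2) (f : T2 -> R) :
  measurable_fun setT h -> bmf f -> bmf (f \o h).
Proof.
move=> mh [mf [M fM]]; split; first exact: measurableT_comp.
by exists M => x; exact: fM.
Qed.

(** * Transfer to the law of one variable, and independence from one variable *)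

Section Law.
Context {R : realType} {dO dZ : measure_display} {Om : measurableType dO}
  {Z : measurableType dZ} (P : probability Om R) (Xi : Om -> Z).
Hypothesis mXi : measurable_fun setT Xi.

Lemma Ex_law (pi : probability Z R) (f : Z -> R) :
  (forall B, measurable B -> P (Xi @^-1` B) = pi B) -> bmf f ->
  Ex P (f \o Xi) = Ex pi f.
Proof.
move=> lawX bf; rewrite /Ex /Rintegral; congr fine.
rewrite [RHS](eq_measure_integral (pushforward P Xi)); last first.
  by move=> B mB _; apply/esym; exact: lawX.
rewrite integral_pushforward//.
  by apply/measurable_EFinP; case: bf.
by apply: (bmf_integrable P); exact: bmf_comp.
Qed.

(** The identity is linear in [f], so it passes from indicators to simple functions. Both sides are
    continuous in [f] for the L1 norm of the law of [Xi], because [Y] is bounded, and simple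
    functions are dense there. *)
Lemma Ex_indep1 (Y : Om -> R) (f : Z -> R) : bmf Y -> bmf f ->
  (forall B, measurable B ->
     Ex P (fun w => Y w * \1_B (Xi w)) = Ex P Y * Ex P (fun w => \1_B (Xi w))) ->
  Ex P (fun w => Y w * f (Xi w)) = Ex P Y * Ex P (fun w => f (Xi w)).
Proof.
move=> bY bf hY.
have bfX : bmf (f \o Xi) by exact: bmf_comp.
(* The approximation takes place under the law of [Xi], so that the [g n] are functions on [Z] and
   can be composed with [Xi]. *)
have intf : (pushforward P Xi).-integrable setT (EFin \o f).
  apply: integrable_pushforward => //; first by apply/measurable_EFinP; case: bf.
  exact: (bmf_integrable P).
have [g [_ _ gf]] := approximation_sfun_integrable measurableT intf.
have bg n : bmf (g n).
  split; first exact: measurable_funP.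
  have [M [_ gM]] := simple_bounded (g n).
  by exists (`|M| + 1) => x; apply: gM => //; rewrite ltr_pwDr// ler_norm.
have bgX n : bmf (fun w => g n (Xi w)) by exact: (bmf_comp mXi (bg n)).
have sg n : Ex P (fun w => Y w * g n (Xi w)) = Ex P Y * Ex P (fun w => g n (Xi w)).
  (* [s] lists the values of [g n], and the [B i] are its level sets. *)
  pose s := finmap.enum_fset (fset_set (range (g n))).
  pose B (i : nat) := g n @^-1` [set nth 0 s i].
  have mB i : measurable (B i) by rewrite /B; exact: measurable_funPTI.
  have b1 i : bmf (fun w => \1_(B i) (Xi w) : R).
    exact: (bmf_comp mXi (bmf_indic (mB i))).
  have gE w : g n (Xi w) = \sum_(i < size s)
      s`_i * \1_(B i) (Xi w) by exact: fimfunEord.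
  under eq_fun do rewrite gE mulr_sumr.
  under [in RHS]eq_fun do rewrite gE.
  rewrite !Ex_sum; last 2 first.
  - by move=> i; exact: bmfZ.
  - by move=> i; apply: bmfM => //; exact: bmfZ.
  rewrite mulr_sumr; apply: eq_bigr => i _.
  under eq_fun do rewrite mulrCA.
  by rewrite !ExZ ?hY 1?mulrCA//; exact: bmfM.
pose del n := Ex P (fun w => `|f (Xi w) - g n (Xi w)|).
have bfg n : bmf (fun w => f (Xi w) - g n (Xi w)) by exact: bmfB.
have del0 : del @ \oo --> (0 : R).
  suff : (fun n => (del n)%:E) @ \oo --> (0 : R)%:E by move=> /fine_cvgP[].
  rewrite [X in X @ _ --> _](_ : _ = (fun n =>
    \int[pushforward P Xi]_z `|(EFin \o f) z - (g n z)%:E|)%E); first exact: gf.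
  apply/funext => n; apply/esym.
  rewrite integral_pushforward//=; last 2 first.
  - by apply/measurable_EFinP; case: (bmf_norm (bmfB bf (bg n))).
  - exact: (bmf_integrable P (bmf_norm (bfg n))).
  rewrite /del /Ex /Rintegral fineK//.
  by apply: integrable_fin_num => //; exact: (bmf_integrable P (bmf_norm (bfg n))).
have [_ [M YM]] := bY.
have key n : `|Ex P (fun w => Y w * f (Xi w)) - Ex P Y * Ex P (fun w => f (Xi w))|
    <= (M + M) * del n.
  (* The defect of the product formula vanishes at [g n], hence the defect at [f] is the one at
     [f - g n]. Each of its two terms is at most [M * del n]. *)
  have -> : Ex P (fun w => Y w * f (Xi w)) - Ex P Y * Ex P (fun w => f (Xi w)) =
    Ex P (fun w => Y w * (f (Xi w) - g n (Xi w))) -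
    Ex P Y * Ex P (fun w => f (Xi w) - g n (Xi w)).
    under [in RHS]eq_fun do rewrite mulrBr.
    by rewrite !ExB ?sg//; [ring|exact: bmfM|exact: bmfM].
  apply: (le_trans (ler_normB _ _)); rewrite mulrDl; apply: lerD.
    apply: (le_trans (le_norm_Ex _ _)); first exact: bmfM.
    rewrite -ExZ; last exact: bmf_norm.
    apply: le_Ex => [||w]; [by apply/bmf_norm/bmfM|exact/bmfZ/bmf_norm|].
    by rewrite normrM ler_wpM2r.
  rewrite normrM; apply: ler_pM => //; last exact: le_norm_Ex.
  apply: (le_trans (le_norm_Ex _ bY)); rewrite -(Ex_cst P M).
  by apply: le_Ex => //; [exact: bmf_norm|exact: bmf_cst].
apply/eqP; rewrite -subr_eq0 -normr_le0.
have : (fun n => (M + M) * del n) @ \oo --> (M + M) * 0 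
  by apply: cvgM => //; exact: cvg_cst.
rewrite mulr0 => h0; rewrite -(cvg_lim (@Rhausdorff R) h0).
apply: limr_ge; [apply: cvgP h0|exact: nearW].
Qed.

End Law.

(** * Independence *)

Section Independence.
Context {R : realType} {dO dZ : measure_display} {Om : measurableType dO}
  {Z : measurableType dZ} (P : probability Om R) {I : eqType} (Idx : set I)
  (X : I -> Om -> Z).
Hypothesis mX : forall i, measurable_fun setT (X i).
Hypothesis indepX : mutually_independent P Idx X.

Let bmfX (f : Z -> R) i : bmf f -> bmf (fun w => f (X i w)).
Proof. by move=> bf; exact: (bmf_comp (mX i) bf). Qed.

Lemma prod_indic (s : seq I) (A : I -> set Om) w :
  \prod_(i <- s) \1_(A i) w = \1_(\bigcap_(i in [set` s]) A i) w :> R.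
Proof.
rewrite [RHS]indicE; case: (boolP (w \in _)) => [|/negP] wA.
  rewrite big_seq big1// => i si; rewrite indicE mem_set//.
  by move: wA; rewrite inE => /(_ i); exact.
apply/eqP; rewrite prodf_seq_eq0; apply: contrapT => /negP/hasPn h; apply: wA.
rewrite inE => i /= si; move: (h i si).
by rewrite indicE /=; case: (boolP (w \in A i)) => [|_]; rewrite ?inE ?eqxx.
Qed.

(** Indicators are replaced by bounded functions one index at a time, by induction on [s]; for [s]
    empty this is the definition of mutual independence. The indicators over an arbitrary [s'] make
    the induction work: to apply [Ex_indep1] at the head [i], the induction hypothesis is used with
    [i] moved into the second list. *)
Lemma Ex_prod_indic (s s' : seq I) (f : I -> Z -> R) (B : I -> set Z) :
  uniq (s ++ s') -> (forall i, i \in s ++ s' -> Idx i) ->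
  (forall i, bmf (f i)) -> (forall i, measurable (B i)) ->
  Ex P (fun w => \prod_(i <- s) f i (X i w) * \prod_(i <- s') \1_(B i) (X i w)) =
  \prod_(i <- s) Ex P (fun w => f i (X i w)) *
  \prod_(i <- s') Ex P (fun w => \1_(B i) (X i w)).
Proof.
elim: s s' B => [|i s IH] s' B us Is bf mB.
  rewrite big_nil mul1r; under eq_fun do rewrite big_nil mul1r.
  have mBX i : measurable (X i @^-1` B i) by rewrite -[_ @^-1` _]setTI; exact: mX.
  have E w : \prod_(i <- s') \1_(B i) (X i w) =
      \1_(\bigcap_(i in [set` s']) (X i @^-1` B i)) w :> R.
    by rewrite -prod_indic.
  under eq_fun do rewrite E.
  apply: EFin_inj; rewrite Ex_indic; last first.
    apply: fin_bigcap_measurable => //; exact: finite_seq.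
  rewrite indepX// -prodEFin; apply: eq_bigr => k _.
  by rewrite -Ex_indic.
move: us; rewrite /= => /andP[iss us].
pose Y w := \prod_(j <- s) f j (X j w) * \prod_(j <- s') \1_(B j) (X j w).
have bY : bmf Y.
  apply: bmfM; first by apply: bmf_prod => j; exact: bmfX.
  by apply: bmf_prod => j; apply: bmfX; exact: bmf_indic.
have Is' : forall j, j \in s ++ s' -> Idx j.
  by move=> j js; apply: Is; rewrite in_cons js orbT.
have EY : Ex P Y = \prod_(j <- s) Ex P (fun w => f j (X j w)) *
    \prod_(j <- s') Ex P (fun w => \1_(B j) (X j w)) by exact: IH.
rewrite big_cons.
under eq_fun do rewrite big_cons -mulrA mulrC.
rewrite (Ex_indep1 (mX i) bY (bf i)) ?EY; first by ring.
move=> C mC; rewrite -EY.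
pose B' j := if j == i then C else B j.
have nis' : i \notin s' by move: iss; rewrite mem_cat negb_or => /andP[].
have B'E j : j \in s' -> B' j = B j.
  by move=> js'; rewrite /B'; case: eqP => // ji; rewrite ji (negbTE nis') in js'.
have := IH (i :: s') B'; rewrite big_cons [B' i]/B' eqxx.
have -> : \prod_(j <- s') Ex P (fun w => \1_(B' j) (X j w)) =
    \prod_(j <- s') Ex P (fun w => \1_(B j) (X j w)).
  by apply: eq_big_seq => j js'; rewrite B'E.
rewrite mulrCA -EY mulrC => <-//; last 3 first.
- rewrite uniq_catC/= uniq_catC us andbT.
  by move: iss; rewrite !mem_cat orbC.
- move=> j; rewrite mem_cat in_cons => js; apply: Is.
  by rewrite /= in_cons mem_cat orbCA.
- by move=> j; rewrite /B'; case: ifP.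
congr (Ex P _); apply/funext => w; rewrite big_cons [B' i]/B' eqxx.
have -> : \prod_(j <- s') \1_(B' j) (X j w) = \prod_(j <- s') \1_(B j) (X j w) :> R.
  by apply: eq_big_seq => j js'; rewrite B'E.
by rewrite /Y; ring.
Qed.

Lemma Ex_prod (s : seq I) (f : I -> Z -> R) :
  uniq s -> (forall i, i \in s -> Idx i) -> (forall i, bmf (f i)) ->
  Ex P (fun w => \prod_(i <- s) f i (X i w)) =
  \prod_(i <- s) Ex P (fun w => f i (X i w)).
Proof.
move=> us Is bf.
have := @Ex_prod_indic s [::] f (fun=> setT); rewrite cats0 big_nil mulr1 => <-//.
by congr (Ex P _); apply/funext => w; rewrite big_nil mulr1.
Qed.

(** Finite sums of monomials in functions of the samples indexed by [S]. An index occurs at most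
    once in a monomial, so that [Ex_prod] computes its expectation. The set [S] bounds the samples
    involved and plays the role of a sigma-algebra. *)
Inductive generated (S : set I) : (Om -> R) -> Prop :=
| generated_monomial k s f : uniq s -> (forall i, i \in s -> S i) ->
    (forall i, bmf (f i)) ->
    generated S (fun w => k * \prod_(i <- s) f i (X i w))
| generatedD Y1 Y2 : generated S Y1 -> generated S Y2 ->
    generated S (fun w => Y1 w + Y2 w).

Lemma generated_sub S S' Y : S `<=` S' -> generated S Y -> generated S' Y.
Proof.
move=> SS'; elim=> [k s f us Ss bf|Y1 Y2 _ Y1S _ Y2S]; last exact: generatedD.
by apply: generated_monomial => // i /Ss /SS'.
Qed.

Lemma generated_bmf S Y : generated S Y -> bmf Y.
Proof.
elim=> [k s f us Ss bf|Y1 Y2 _ bY1 _ bY2]; last exact: bmfD.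
by apply/bmfZ/bmf_prod => i; exact: bmfX.
Qed.

Lemma generated_cst S k : generated S (fun=> k).
Proof.
rewrite (_ : (fun=> k) =
  fun w => k * \prod_(i <- [::]) (fun _ _ => 0 : R) i (X i w)).
  by apply: (@generated_monomial S k [::] (fun _ _ => 0)) => // i; exact: bmf_cst.
by apply/funext => w; rewrite big_nil mulr1.
Qed.

Lemma generated_var S i (f : Z -> R) : S i -> bmf f -> generated S (fun w => f (X i w)).
Proof.
move=> Si bf; rewrite (_ : (fun w => f (X i w)) =
  fun w => 1 * \prod_(j <- [:: i]) (fun=> f) j (X j w)).
  by apply: (@generated_monomial S 1 [:: i] (fun=> f)) => // j; rewrite inE => /eqP ->.
by apply/funext => w; rewrite big_seq1 mul1r.
Qed.

(** Padding by ones brings two monomials to a common duplicate-free list of indices. *)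
Lemma prod_extend (s s' : seq I) (F : I -> R) : uniq s ->
  \prod_(i <- undup (s ++ s')) (if i \in s then F i else 1) = \prod_(i <- s) F i.
Proof.
move=> us; rewrite -big_mkcond -big_filter; apply: perm_big; apply: uniq_perm => //.
  by rewrite filter_uniq// undup_uniq.
by move=> i; rewrite mem_filter mem_undup mem_cat; case: (i \in s).
Qed.

(** By distributivity two monomials suffice. Factors that share an index are merged into a single
    function of that sample, which keeps the list of indices free of duplicates. *)
Lemma generatedM S Y1 Y2 : generated S Y1 -> generated S Y2 ->
  generated S (fun w => Y1 w * Y2 w).
Proof.
elim=> [k s f us Ss bf|Y Y' _ IH _ IH' gY2]; last first.
  under eq_fun do rewrite mulrDl.
  by apply: generatedD; [exact: IH|exact: IH'].
elim=> [k' s' f' us' Ss' bf'|Y Y' _ IH _ IH']; last first.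
  by under eq_fun do rewrite mulrDr; exact: generatedD.
pose g i z := (if i \in s then f i z else 1) * (if i \in s' then f' i z else 1).
have E : (fun w => k * \prod_(i <- s) f i (X i w) * (k' * \prod_(i <- s') f' i (X i w))) =
    fun w => k * k' * \prod_(i <- undup (s ++ s')) g i (X i w).
  apply/funext => w; rewrite big_split/= prod_extend//.
  have -> : \prod_(i <- undup (s ++ s')) (if i \in s' then f' i (X i w) else 1) =
      \prod_(i <- s') f' i (X i w).
    rewrite -(prod_extend s _ us'); apply: perm_big; apply: uniq_perm.
    - exact: undup_uniq.
    - exact: undup_uniq.
    - by move=> i; rewrite !mem_undup !mem_cat orbC.
  by ring.
rewrite E; apply: generated_monomial; first exact: undup_uniq.
  by move=> i; rewrite mem_undup mem_cat => /orP[/Ss|/Ss'].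
move=> i; rewrite /g; apply: bmfM.
  by case: (i \in s) => //; exact: bmf_cst.
by case: (i \in s') => //; exact: bmf_cst.
Qed.

Lemma generatedZ S k Y : generated S Y -> generated S (fun w => k * Y w).
Proof. by move=> gY; apply: generatedM => //; exact: generated_cst. Qed.

Lemma generated_sum S (J : Type) (s : seq J) (F : J -> Om -> R) :
  (forall j, generated S (F j)) -> generated S (fun w => \sum_(j <- s) F j w).
Proof.
move=> gF; elim: s => [|j s IH].
  by under eq_fun do rewrite big_nil; exact: generated_cst.
by under eq_fun do rewrite big_cons; exact: generatedD.
Qed.

(** By bilinearity it is enough to treat two monomials. Their index lists are disjoint, so their
    product is a monomial over the concatenation, and [Ex_prod] applies to it and to each factor. *)
Lemma ExM_indep S S' Y1 Y2 : S `<=` Idx -> S' `<=` Idx -> S `&` S' `<=` set0 ->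
  generated S Y1 -> generated S' Y2 ->
  Ex P (fun w => Y1 w * Y2 w) = Ex P Y1 * Ex P Y2.
Proof.
move=> SI S'I SS'; elim=> [k s f us Ss bf|Y Y' gY IH gY' IH' gY2]; last first.
  under eq_fun do rewrite mulrDl.
  have [bY [bY' bY2]] := (generated_bmf gY, (generated_bmf gY', generated_bmf gY2)).
  by rewrite !ExD//; [rewrite IH// IH'// mulrDl|exact: bmfM|exact: bmfM].
elim=> [k' s' f' us' Ss' bf'|Y Y' gY IH gY' IH']; last first.
  under eq_fun do rewrite mulrDr.
  have [bY bY'] := (generated_bmf gY, generated_bmf gY').
  have bs : bmf (fun w => k * \prod_(i <- s) f i (X i w)).
    by apply/bmfZ/bmf_prod => i; exact: bmfX.
  by rewrite !ExD//; [rewrite IH// IH'// mulrDr|exact: bmfM|exact: bmfM].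
have dis i : i \in s -> i \in s' -> False.
  by move=> /Ss si /Ss' s'i; exact: (SS' i).
pose g i := if i \in s then f i else f' i.
have bg i : bmf (g i) by rewrite /g; case: ifP.
have gs i : i \in s -> g i = f i by rewrite /g => ->.
have gs' i : i \in s' -> g i = f' i.
  by move=> is'; rewrite /g; case: ifP => // /dis /(_ is').
have E w : k * \prod_(i <- s) f i (X i w) * (k' * \prod_(i <- s') f' i (X i w)) =
    k * k' * \prod_(i <- s ++ s') g i (X i w).
  rewrite big_cat/=.
  have -> : \prod_(i <- s) g i (X i w) = \prod_(i <- s) f i (X i w).
    by apply: eq_big_seq => i /gs ->.
  have -> : \prod_(i <- s') g i (X i w) = \prod_(i <- s') f' i (X i w).
    by apply: eq_big_seq => i /gs' ->.
  by ring.
under eq_fun do rewrite E.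
have bp (t : seq I) (h : I -> Z -> R) :
  (forall i, bmf (h i)) -> bmf (fun w => \prod_(i <- t) h i (X i w)).
  by move=> bh; apply: bmf_prod => i; exact: bmfX.
rewrite !ExZ; try exact: bp.
have us'' : uniq (s ++ s').
  rewrite cat_uniq us us' andbT/=; apply/hasPn => i /= is'.
  by apply/negP => /dis; exact.
have sI i : i \in s -> Idx i by move=> /Ss/SI.
have s'I i : i \in s' -> Idx i by move=> /Ss'/S'I.
have s''I i : i \in s ++ s' -> Idx i by rewrite mem_cat => /orP[/sI|/s'I].
rewrite !Ex_prod//.
rewrite big_cat/=.
have -> : \prod_(i <- s) Ex P (fun w => g i (X i w)) =
    \prod_(i <- s) Ex P (fun w => f i (X i w)).
  by apply: eq_big_seq => i /gs ->.
have -> : \prod_(i <- s') Ex P (fun w => g i (X i w)) =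
    \prod_(i <- s') Ex P (fun w => f' i (X i w)).
  by apply: eq_big_seq => i /gs' ->.
by ring.
Qed.
End Independence.

(** * Euclidean and operator norms *)

Section Euclidean.
Context {R : realType}.

(** The discriminant form of Cauchy-Schwarz, with [p], [q], [c] standing for two squared norms and
    an inner product. It serves finite sums, vectors and, through [mink_le], random vectors in
    L2. *)
Lemma discr_le (p q c : R) :
  0 <= q -> (forall l, 0 <= p + 2 * l * c + l ^+ 2 * q) ->
  c <= Num.sqrt p * Num.sqrt q.
Proof.
move=> q0 h; have p0 : 0 <= p by have := h 0; rewrite mulr0 mul0r expr0n mul0r !addr0.
rewrite -sqrtrM//; apply: (le_trans (ler_norm c)); rewrite -sqrtr_sqr; apply: ler_wsqrtr.
move: q0; rewrite le_eqVlt => /orP[/eqP q0|q0].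
  have [->|c0] := eqVneq c 0; first by rewrite expr0n mulr_ge0// -q0.
  (* For [q = 0] the polynomial is affine in [l]; if [c] were nonzero, it would take the value -1 at
     this point. *)
  have := h (- (p + 1) / (2 * c)); rewrite -q0 mulr0 addr0.
  have -> : p + 2 * (- (p + 1) / (2 * c)) * c = - 1 by field.
  by rewrite ler0N1.
(* The minimiser of the quadratic polynomial. *)
have := h (- c / q).
have -> : p + 2 * (- c / q) * c + (- c / q) ^+ 2 * q = (p * q - c ^+ 2) / q.
  by field; rewrite gt_eqF.
by rewrite pmulr_lge0 ?invr_gt0// subr_ge0.
Qed.

Lemma mink_le (p q c : R) :
  0 <= q -> (forall l, 0 <= p + 2 * l * c + l ^+ 2 * q) ->
  Num.sqrt (p + 2 * c + q) <= Num.sqrt p + Num.sqrt q.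
Proof.
move=> q0 h; have p0 : 0 <= p by have := h 0; rewrite mulr0 mul0r expr0n mul0r !addr0.
rewrite -[leRHS]ger0_norm ?addr_ge0 ?sqrtr_ge0// -sqrtr_sqr; apply: ler_wsqrtr.
rewrite sqrrD !sqr_sqrtr// lerD2r lerD2l.
by have := discr_le q0 h; rewrite mulr2n; lra.
Qed.

Lemma sum_cauchy (I : finType) (x y : I -> R) :
  \sum_i x i * y i <= Num.sqrt (\sum_i x i ^+ 2) * Num.sqrt (\sum_i y i ^+ 2).
Proof.
apply: discr_le => [|l]; first by apply: sumr_ge0 => i _; exact: sqr_ge0.
have -> : \sum_i x i ^+ 2 + 2 * l * \sum_i x i * y i + l ^+ 2 * \sum_i y i ^+ 2 =
    \sum_i (x i + l * y i) ^+ 2.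
  by rewrite !mulr_sumr -!big_split/=; apply: eq_bigr => i _; ring.
by apply: sumr_ge0 => i _; exact: sqr_ge0.
Qed.

Lemma sum_minkowski (I : finType) (x y : I -> R) :
  Num.sqrt (\sum_i (x i + y i) ^+ 2) <=
  Num.sqrt (\sum_i x i ^+ 2) + Num.sqrt (\sum_i y i ^+ 2).
Proof.
have -> : \sum_i (x i + y i) ^+ 2 =
    \sum_i x i ^+ 2 + 2 * (\sum_i x i * y i) + \sum_i y i ^+ 2.
  by rewrite !mulr_sumr -!big_split/=; apply: eq_bigr => i _; ring.
apply: mink_le => [|l]; first by apply: sumr_ge0 => i _; exact: sqr_ge0.
have -> : \sum_i x i ^+ 2 + 2 * l * \sum_i x i * y i + l ^+ 2 * \sum_i y i ^+ 2 =
    \sum_i (x i + l * y i) ^+ 2.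
  by rewrite !mulr_sumr -!big_split/=; apply: eq_bigr => i _; ring.
by apply: sumr_ge0 => i _; exact: sqr_ge0.
Qed.

Definition dot {d} (u v : 'cV[R]_d) : R := \sum_i u i 0 * v i 0.

Context {d : nat}.
Implicit Types (u v w : 'cV[R]_d) (M : 'M[R]_d).

Lemma dotC u v : dot u v = dot v u.
Proof. by apply: eq_bigr => i _; rewrite mulrC. Qed.

Lemma dotDl u v w : dot (u + v) w = dot u w + dot v w.
Proof. by rewrite -big_split/=; apply: eq_bigr => i _; rewrite mxE mulrDl. Qed.

Lemma dotDr u v w : dot w (u + v) = dot w u + dot w v.
Proof. by rewrite dotC dotDl !(dotC w). Qed.

Lemma dotZl k u v : dot (k *: u) v = k * dot u v.
Proof. by rewrite mulr_sumr; apply: eq_bigr => i _; rewrite mxE mulrA. Qed.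

Lemma dotZr k u v : dot v (k *: u) = k * dot v u.
Proof. by rewrite dotC dotZl dotC. Qed.

Lemma dot0l v : dot 0 v = 0.
Proof. by rewrite -(scale0r 0) dotZl mul0r. Qed.

Lemma dot_suml (I : Type) (s : seq I) (F : I -> 'cV[R]_d) v :
  dot (\sum_(i <- s) F i) v = \sum_(i <- s) dot (F i) v.
Proof.
elim: s => [|i s IH]; first by rewrite !big_nil dot0l.
by rewrite !big_cons dotDl IH.
Qed.

Lemma dot_sumr (I : Type) (s : seq I) (F : I -> 'cV[R]_d) v :
  dot v (\sum_(i <- s) F i) = \sum_(i <- s) dot v (F i).
Proof. by rewrite dotC dot_suml; apply: eq_bigr => i _; rewrite dotC. Qed.

Lemma dot_ge0 u : 0 <= dot u u.
Proof. by apply: sumr_ge0 => i _; exact: sqr_ge0. Qed.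

Lemma dot_tr M u v : dot (M *m u) v = dot u (M^T *m v).
Proof.
transitivity (\sum_i \sum_j M i j * u j 0 * v i 0).
  by apply: eq_bigr => i _; rewrite mxE mulr_suml.
rewrite exchange_big/=; apply: eq_bigr => j _; rewrite mxE mulr_sumr.
by apply: eq_bigr => i _; rewrite mxE; ring.
Qed.

Lemma enorm_sqr u : enorm u ^+ 2 = dot u u.
Proof. by rewrite sqr_sqrtr ?dot_ge0//; apply: sumr_ge0 => i _; exact: sqr_ge0. Qed.

Lemma enorm_sqrt u : enorm u = Num.sqrt (dot u u).
Proof. by []. Qed.

Lemma enorm_ge0 u : 0 <= enorm u.
Proof. exact: sqrtr_ge0. Qed.

Lemma dot_quad u v l :
  dot u u + 2 * l * dot u v + l ^+ 2 * dot v v = dot (u + l *: v) (u + l *: v).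
Proof. by rewrite dotDl !dotDr !dotZl !dotZr (dotC v u); ring. Qed.

Lemma dot_cauchy u v : dot u v <= enorm u * enorm v.
Proof. by apply: discr_le => [|l]; [exact: dot_ge0|rewrite dot_quad dot_ge0]. Qed.

Lemma enormD u v : enorm (u + v) <= enorm u + enorm v.
Proof.
rewrite !enorm_sqrt -[v in X in X <= _]scale1r -dot_quad mulr1 expr1n mul1r.
by apply: mink_le => [|l]; [exact: dot_ge0|rewrite dot_quad dot_ge0].
Qed.

Lemma enormZ k u : enorm (k *: u) = `|k| * enorm u.
Proof.
rewrite !enorm_sqrt dotZl dotZr mulrA -expr2 sqrtrM ?sqr_ge0//.
by rewrite sqrtr_sqr.
Qed.

Lemma enorm0 : enorm (0 : 'cV[R]_d) = 0.
Proof. by rewrite -(scale0r 0) enormZ normr0 mul0r. Qed.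

Lemma enorm_sum (I : Type) (s : seq I) (F : I -> 'cV[R]_d) :
  enorm (\sum_(i <- s) F i) <= \sum_(i <- s) enorm (F i).
Proof.
elim: s => [|i s IH]; first by rewrite !big_nil enorm0.
by rewrite !big_cons; apply: (le_trans (enormD _ _)); rewrite lerD2l.
Qed.

Lemma enorm_le0 u : enorm u <= 0 -> u = 0.
Proof.
move=> u0; have := enorm_sqr u.
have -> : enorm u = 0 by apply/eqP; rewrite eq_le u0 enorm_ge0.
rewrite expr0n/= => /esym/eqP; rewrite psumr_eq0 => [/allP h|i _]; last exact: sqr_ge0.
apply/colP => i; have := h i (mem_index_enum _).
by rewrite mxE/= -expr2 sqrf_eq0 => /eqP.
Qed.

Lemma norm_le_enorm u i : `|u i 0| <= enorm u.
Proof.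
rewrite -sqrtr_sqr; apply: ler_wsqrtr; rewrite (bigD1 i)//= lerDl.
by apply: sumr_ge0 => j _; exact: sqr_ge0.
Qed.

(** The supremum in [opnorm] is only usable once its set is known to be bounded. The bound holds
    since every coordinate of a vector of the unit ball is at most 1 in absolute value. *)
Lemma opnorm_has_ubound M :
  has_ubound [set enorm (M *m u) | u in [set u : 'cV[R]_d | enorm u <= 1]].
Proof.
exists (Num.sqrt (\sum_i (\sum_j `|M i j|) ^+ 2)) => _ [u /= u1 <-].
apply: ler_wsqrtr; apply: ler_sum => i _; rewrite -[leLHS]real_normK ?num_real//.
rewrite lerXn2r ?nnegrE ?sumr_ge0// mxE.
apply: (le_trans (ler_norm_sum _ _ _)); apply: ler_sum => j _.
rewrite normrM ler_piMr//; exact: le_trans (norm_le_enorm u j) u1.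
Qed.

Lemma enorm_mulmx M u : enorm (M *m u) <= opnorm M * enorm u.
Proof.
have [u0|u0] := leP (enorm u) 0.
  by rewrite (enorm_le0 u0) mulmx0 !enorm0 mulr0.
have -> : enorm (M *m u) = enorm (M *m ((enorm u)^-1 *: u)) * enorm u.
  by rewrite -scalemxAr enormZ gtr0_norm ?invr_gt0// mulrAC mulVf ?mul1r// gt_eqF.
rewrite ler_pM2r//; apply: ub_le_sup; first exact: opnorm_has_ubound.
exists ((enorm u)^-1 *: u) => //=.
by rewrite enormZ gtr0_norm ?invr_gt0// mulVf// gt_eqF.
Qed.

Lemma opnorm_ge0 M : 0 <= opnorm M.
Proof.
apply: ub_le_sup; first exact: opnorm_has_ubound.
by exists 0; rewrite /= ?mulmx0 enorm0 ?ler01.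
Qed.

(** Turns the uniform bound [hCA] on operator norms into bounded entries, as [bmf] requires. *)
Lemma norm_le_opnorm M i j : `|M i j| <= opnorm M.
Proof.
pose e : 'cV[R]_d := delta_mx j 0.
have -> : M i j = (M *m e) i 0 by rewrite -colE mxE.
apply: (le_trans (norm_le_enorm _ _)); apply: (le_trans (enorm_mulmx _ _)).
have -> : enorm e = 1; last by rewrite mulr1.
rewrite /enorm (bigD1 j)//= big1 ?addr0; last first.
  by move=> k kj; rewrite mxE (negbTE kj) expr0n.
by rewrite mxE !eqxx expr1n sqrtr1.
Qed.

End Euclidean.

(** * Random vectors *)

Definition bmv {R : realType} {dT} {T : measurableType dT} {m n}
  (X : T -> 'M[R]_(m, n)) : Prop := forall i j, bmf (fun w => X w i j).

Section RandomVectors.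
Context {R : realType} {dT : measure_display} {T : measurableType dT}
  (P : probability T R).

Lemma bmv_cst {m n} (M : 'M[R]_(m, n)) : bmv (fun _ : T => M).
Proof. by move=> i j; exact: bmf_cst. Qed.

Lemma bmvD {m n} (X Y : T -> 'M[R]_(m, n)) :
  bmv X -> bmv Y -> bmv (fun w => X w + Y w).
Proof. by move=> bX bY i j; under eq_fun do rewrite mxE; exact: bmfD. Qed.

Lemma bmvZ {m n} k (X : T -> 'M[R]_(m, n)) : bmv X -> bmv (fun w => k *: X w).
Proof. by move=> bX i j; under eq_fun do rewrite mxE; exact: bmfZ. Qed.

Lemma bmvB {m n} (X Y : T -> 'M[R]_(m, n)) :
  bmv X -> bmv Y -> bmv (fun w => X w - Y w).
Proof. by move=> bX bY i j; under eq_fun do rewrite !mxE; exact: bmfB. Qed.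

Lemma bmvM {m n p} (X : T -> 'M[R]_(m, n)) (Y : T -> 'M[R]_(n, p)) :
  bmv X -> bmv Y -> bmv (fun w => X w *m Y w).
Proof.
move=> bX bY i j; under eq_fun do rewrite mxE.
by apply: bmf_sum => k; exact: bmfM.
Qed.

Lemma bmv_tr {m n} (X : T -> 'M[R]_(m, n)) : bmv X -> bmv (fun w => (X w)^T).
Proof. by move=> bX i j; under eq_fun do rewrite mxE; exact: bX. Qed.

Context {d : nat}.
Implicit Types X Y : T -> 'cV[R]_d.

Lemma bmf_dot X Y : bmv X -> bmv Y -> bmf (fun w => dot (X w) (Y w)).
Proof. by move=> bX bY; apply: bmf_sum => i; exact: bmfM. Qed.

Lemma bmf_enorm_sqr X : bmv X -> bmf (fun w => enorm (X w) ^+ 2).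
Proof. by move=> bX; under eq_fun do rewrite enorm_sqr; exact: bmf_dot. Qed.

(** The squared L2 norm. Estimates are made on this real number, and [Lnorm] enters only through
    [Lnorm2_msq]. *)
Definition msq X : R := Ex P (fun w => enorm (X w) ^+ 2).

Lemma msqE X : msq X = Ex P (fun w => dot (X w) (X w)).
Proof. by congr (Ex P _); apply/funext => w; rewrite enorm_sqr. Qed.

Lemma msq_ge0 X : 0 <= msq X.
Proof. by apply: Ex_ge0 => w; exact: sqr_ge0. Qed.

Lemma msq_quad X Y l : bmv X -> bmv Y ->
  msq X + 2 * l * Ex P (fun w => dot (X w) (Y w)) + l ^+ 2 * msq Y =
  msq (fun w => X w + l *: Y w).
Proof.
move=> bX bY; have [bXX [bXY bYY]] := (bmf_dot bX bX, (bmf_dot bX bY, bmf_dot bY bY)).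
rewrite !msqE; under [in RHS]eq_fun do rewrite -dot_quad.
by rewrite !ExD ?ExZ//; first [exact: bmfZ|apply: bmfD => //; exact: bmfZ].
Qed.

Lemma msqD X Y : bmv X -> bmv Y ->
  msq (fun w => X w + Y w) =
  msq X + 2 * Ex P (fun w => dot (X w) (Y w)) + msq Y.
Proof.
move=> bX bY; have := msq_quad 1 bX bY; rewrite mulr1 expr1n mul1r => ->.
by congr (msq _); apply/funext => w; rewrite scale1r.
Qed.

Lemma msq_minkowski X Y : bmv X -> bmv Y ->
  Num.sqrt (msq (fun w => X w + Y w)) <= Num.sqrt (msq X) + Num.sqrt (msq Y).
Proof.
move=> bX bY; rewrite msqD//; apply: mink_le => [|l]; first exact: msq_ge0.
by rewrite msq_quad// msq_ge0.
Qed.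

Lemma msq_cst (v : 'cV[R]_d) : msq (fun=> v) = enorm v ^+ 2.
Proof. exact: Ex_cst. Qed.

Lemma msqZ k X : bmv X -> msq (fun w => k *: X w) = k ^+ 2 * msq X.
Proof.
move=> bX; rewrite /msq -ExZ; last exact: bmf_enorm_sqr.
congr (Ex P _); apply/funext => w; rewrite enormZ exprMn.
by rewrite real_normK// num_real.
Qed.

Lemma Lnorm2_msq X : bmv X ->
  Lnorm P 2%:E (fun w => (enorm (X w))%:E) = (Num.sqrt (msq X))%:E.
Proof.
move=> bX; rewrite unlock.
under eq_integral => w _.
  rewrite gee0_abs ?lee_fin ?enorm_ge0// poweR_EFin powR_mulrn ?enorm_ge0//.
  over.
have intX := bmf_integrable P (bmf_enorm_sqr bX).
rewrite -[X in (X `^ _)%E]fineK; last exact: integrable_fin_num.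
by rewrite poweR_EFin powR12_sqrt// msq_ge0.
Qed.

(** Jensen's inequality: each coordinate has nonnegative variance. *)
Lemma enorm_mean_mx X : bmv X -> enorm (mean_mx P X) ^+ 2 <= msq X.
Proof.
move=> bX; rewrite enorm_sqr msqE Ex_sum; last by move=> i; exact: bmfM.
apply: ler_sum => i _; rewrite mxE -/(Ex P _); set m := Ex P _.
have : 0 <= Ex P (fun w => (X w i 0 - m) ^+ 2).
  by apply: Ex_ge0 => w; exact: sqr_ge0.
have b1 : bmf (fun w => X w i 0 * X w i 0) by exact: bmfM.
have b2 : bmf (fun w => (- 2 * m) * X w i 0) by exact: bmfZ.
have E : (fun w => (X w i 0 - m) ^+ 2) =
    fun w => X w i 0 * X w i 0 + (- 2 * m) * X w i 0 + m ^+ 2.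
  by apply/funext => w; ring.
rewrite E !ExD ?ExZ ?Ex_cst//;
  try first [exact: bmf_cst | exact: bmfD].
by rewrite -/m; lra.
Qed.

Lemma mean_mulmx {m n p} (M : 'M[R]_(n, p)) (X : T -> 'M[R]_(m, n)) : bmv X ->
  mean_mx P (fun w => X w *m M) = mean_mx P X *m M.
Proof.
move=> bX; apply/matrixP => i j; rewrite !mxE -/(Ex P _).
under eq_fun do (rewrite mxE; under eq_bigr do rewrite mulrC).
rewrite Ex_sum; last by move=> k; exact: bmfZ.
by apply: eq_bigr => k _; rewrite ExZ// mxE mulrC.
Qed.

Lemma mean_mxD {m n} (X Y : T -> 'M[R]_(m, n)) : bmv X -> bmv Y ->
  mean_mx P (fun w => X w + Y w) = mean_mx P X + mean_mx P Y.
Proof.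
move=> bX bY; apply/matrixP => i j; rewrite !mxE -!/(Ex P _) -ExD//.
by congr (Ex P _); apply/funext => w; rewrite mxE.
Qed.

Lemma mean_mxZ {m n} k (X : T -> 'M[R]_(m, n)) : bmv X ->
  mean_mx P (fun w => k *: X w) = k *: mean_mx P X.
Proof.
move=> bX; apply/matrixP => i j; rewrite !mxE -!/(Ex P _) -ExZ//.
by congr (Ex P _); apply/funext => w; rewrite mxE.
Qed.

Lemma mean_mx_cst {m n} (M : 'M[R]_(m, n)) : mean_mx P (fun=> M) = M.
Proof. by apply/matrixP => i j; rewrite mxE; exact: Ex_cst. Qed.

Lemma Ex_dotl X v : bmv X -> Ex P (fun w => dot (X w) v) = dot (mean_mx P X) v.
Proof.
move=> bX; rewrite Ex_sum; last first.
  by move=> i; apply: bmfM => //; exact: bmf_cst.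
apply: eq_bigr => i _; rewrite mxE mulrC -ExZ//.
by congr (Ex P _); apply/funext => w; rewrite mulrC.
Qed.

End RandomVectors.

(** * Independence for random vectors and matrices *)

Section IndependentVectors.
Context {R : realType} {dO dZ : measure_display} {Om : measurableType dO}
  {Z : measurableType dZ} (P : probability Om R) {I : eqType} (Idx : set I)
  (X : I -> Om -> Z).
Hypothesis mX : forall i, measurable_fun setT (X i).
Hypothesis indepX : mutually_independent P Idx X.

Definition gen_mx (S : set I) {m n} (W : Om -> 'M[R]_(m, n)) : Prop :=
  forall i j, generated X S (fun w => W w i j).

Lemma gen_mx_bmv S m n (W : Om -> 'M[R]_(m, n)) : gen_mx S W -> bmv W.
Proof. by move=> gW i j; exact: generated_bmf (gW i j). Qed.

Lemma gen_mx_sub S S' m n (W : Om -> 'M[R]_(m, n)) :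
  S `<=` S' -> gen_mx S W -> gen_mx S' W.
Proof. by move=> SS' gW i j; apply: generated_sub SS' (gW i j). Qed.

Lemma gen_mx_cst S m n (M : 'M[R]_(m, n)) : gen_mx S (fun=> M).
Proof. by move=> i j; exact: generated_cst. Qed.

Lemma gen_mx_var (S : set I) i m n (F : Z -> 'M[R]_(m, n)) :
  S i -> bmv F -> gen_mx S (fun w => F (X i w)).
Proof. by move=> Si bF k l; exact: (generated_var X Si (bF k l)). Qed.

Lemma gen_mxD S m n (W Y : Om -> 'M[R]_(m, n)) :
  gen_mx S W -> gen_mx S Y -> gen_mx S (fun w => W w + Y w).
Proof. by move=> gW gY i j; under eq_fun do rewrite mxE; exact: generatedD. Qed.

Lemma gen_mxZ S k m n (W : Om -> 'M[R]_(m, n)) :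
  gen_mx S W -> gen_mx S (fun w => k *: W w).
Proof. by move=> gW i j; under eq_fun do rewrite mxE; exact: generatedZ. Qed.

Lemma gen_mx_sum S (J : Type) (s : seq J) m n (F : J -> Om -> 'M[R]_(m, n)) :
  (forall j, gen_mx S (F j)) -> gen_mx S (fun w => \sum_(j <- s) F j w).
Proof.
move=> gF i j; under eq_fun do rewrite summxE.
by apply: generated_sum => k; exact: gF.
Qed.

Lemma gen_mxM S m n p (W : Om -> 'M[R]_(m, n)) (Y : Om -> 'M[R]_(n, p)) :
  gen_mx S W -> gen_mx S Y -> gen_mx S (fun w => W w *m Y w).
Proof.
move=> gW gY i j; under eq_fun do rewrite mxE.
by apply: generated_sum => k; exact: generatedM.
Qed.

Lemma gen_mx_tr S m n (W : Om -> 'M[R]_(m, n)) :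
  gen_mx S W -> gen_mx S (fun w => (W w)^T).
Proof. by move=> gW i j; under eq_fun do rewrite mxE; exact: gW. Qed.

Lemma mean_mulmx_indep S S' m n p (W : Om -> 'M[R]_(m, n)) (Y : Om -> 'M[R]_(n, p)) :
  S `<=` Idx -> S' `<=` Idx -> S `&` S' `<=` set0 -> gen_mx S W -> gen_mx S' Y ->
  mean_mx P (fun w => W w *m Y w) = mean_mx P W *m mean_mx P Y.
Proof.
move=> SI S'I SS' gW gY; apply/matrixP => i j; rewrite !mxE -/(Ex P _).
under eq_fun do rewrite mxE.
rewrite Ex_sum; last first.
  by move=> k; apply: bmfM; [exact: (gen_mx_bmv gW)|exact: (gen_mx_bmv gY)].
apply: eq_bigr => k _; rewrite !mxE -!/(Ex P _).
exact: (ExM_indep mX indepX SI S'I SS' (gW i k) (gY k j)).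
Qed.

(** The source of every orthogonality relation in L2: it is enough that one of the two independent
    vectors be centred. *)
Lemma Ex_dot_indep0 S S' d (V Y : Om -> 'cV[R]_d) :
  S `<=` Idx -> S' `<=` Idx -> S `&` S' `<=` set0 -> gen_mx S V -> gen_mx S' Y ->
  mean_mx P V = 0 -> Ex P (fun w => dot (V w) (Y w)) = 0.
Proof.
move=> SI S'I SS' gV gY V0; rewrite Ex_sum; last first.
  by move=> k; apply: bmfM; [exact: (gen_mx_bmv gV)|exact: (gen_mx_bmv gY)].
apply: big1 => k _; rewrite (ExM_indep mX indepX SI S'I SS' (gV k 0) (gY k 0)).
by move/matrixP/(_ k 0): V0; rewrite !mxE -/(Ex P _) => ->; rewrite mul0r.
Qed.

Section Law.
Variables (i : I) (pi : probability Z R).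
Hypothesis Ii : Idx i.
Hypothesis lawi : forall B, measurable B -> P (X i @^-1` B) = pi B.

Lemma mean_mx_law m n (F : Z -> 'M[R]_(m, n)) : bmv F ->
  mean_mx P (fun w => F (X i w)) = mean_mx pi F.
Proof.
by move=> bF; apply/matrixP => k l; rewrite !mxE; exact: (Ex_law (mX i) lawi (bF k l)).
Qed.

Lemma msq_law d (F : Z -> 'cV[R]_d) : bmv F ->
  msq P (fun w => F (X i w)) = msq pi F.
Proof. by move=> bF; exact: (Ex_law (mX i) lawi (bmf_enorm_sqr bF)). Qed.

(** Separates the vector from the matrix, so that independence can be applied entry by entry. *)
Lemma dot_gram d (M : 'M[R]_d) (x : 'cV[R]_d) :
  dot (M *m x) (M *m x) =
  \sum_k \sum_l x k 0 * x l 0 * (M^T *m M) k l.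
Proof.
rewrite dot_tr mulmxA; apply: eq_bigr => k _; rewrite mxE mulr_sumr.
by apply: eq_bigr => l _; ring.
Qed.

(** This replaces conditioning on [W]. By independence the entries of the Gram matrix of [M] may be
    replaced by their means [g]; what remains is a deterministic quadratic form evaluated at [W w],
    and the hypothesis bounds it pointwise with [u := W w]. *)
Lemma msq_mulmx_law S d (M : Z -> 'M[R]_d) (W : Om -> 'cV[R]_d) (k : R) :
  S `<=` Idx -> ~ S i -> bmv M -> gen_mx S W ->
  (forall u, msq pi (fun z => M z *m u) <= k * enorm u ^+ 2) ->
  msq P (fun w => M (X i w) *m W w) <= k * msq P W.
Proof.
move=> SI Si bM gW hM.
pose G z := (M z)^T *m M z.
have bG : bmv G by apply: bmvM => //; exact: bmv_tr.
have bW := gen_mx_bmv gW.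
have bGX a b : bmf (fun w => G (X i w) a b) by exact: (bmf_comp (mX i) (bG a b)).
pose g a b := Ex pi (fun z => G z a b).
have msq_g u : msq pi (fun z => M z *m u) = \sum_a \sum_b u a 0 * u b 0 * g a b.
  rewrite msqE; under eq_fun do rewrite dot_gram.
  rewrite Ex_sum; last by move=> a; apply: bmf_sum => b; exact: bmfZ.
  apply: eq_bigr => a _; rewrite Ex_sum; last by move=> b; exact: bmfZ.
  by apply: eq_bigr => b _; rewrite ExZ.
have -> : msq P (fun w => M (X i w) *m W w) =
    Ex P (fun w => \sum_a \sum_b W w a 0 * W w b 0 * g a b).
  rewrite msqE; under eq_fun do rewrite dot_gram.
  rewrite !Ex_sum; first last.
  - by move=> a; apply: bmf_sum => b; apply: bmfM => //; exact: bmfM.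
  - by move=> a; apply: bmf_sum => b; apply: bmfM; [exact: bmfM|exact: bmf_cst].
  apply: eq_bigr => a _; rewrite !Ex_sum; first last.
  - by move=> b; apply: bmfM => //; exact: bmfM.
  - by move=> b; apply: bmfM; [exact: bmfM|exact: bmf_cst].
  apply: eq_bigr => b _; under [in RHS]eq_fun do rewrite mulrC.
  rewrite ExZ; last exact: bmfM.
  have gi : generated X [set i] (fun w => G (X i w) a b).
    by apply: (generated_var X _ (bG a b)).
  rewrite (ExM_indep mX indepX SI _ _ (generatedM (gW a 0) (gW b 0)) gi).
  - by rewrite mulrC; congr (_ * _); exact: (Ex_law (mX i) lawi (bG a b)).
  - by move=> j ->.
  - by move=> j [Sj ji]; apply: Si; rewrite -ji.
rewrite /msq -ExZ; last exact: bmf_enorm_sqr.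
apply: le_Ex.
- apply: bmf_sum => a; apply: bmf_sum => b; apply: bmfM; last exact: bmf_cst.
  exact: bmfM.
- by apply: bmfZ; exact: bmf_enorm_sqr.
- by move=> w; rewrite -msq_g.
Qed.

End Law.
End IndependentVectors.

(** * Federated linear stochastic approximation *)

Section Federated.
Context (R : realType) (dZ : measure_display) (Z : measurableType dZ)
  (dO : measure_display) (Omega : measurableType dO) (P : probability Omega R)
  (N d : nat) (hN : (0 < N)%N)
  (pi : 'I_N -> probability Z R)
  (A : 'I_N -> Z -> 'M[R]_d) (b : 'I_N -> Z -> 'cV[R]_d)
  (mA : forall c i j, measurable_fun setT (fun z => A c z i j))
  (mb : forall c i j, measurable_fun setT (fun z => b c z i j))
  (ths : 'cV[R]_d) (thc : 'I_N -> 'cV[R]_d)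
  (hths : Abar pi A *m ths = bbar pi b)
  (hthc : forall c, Abar_c pi A c *m thc c = bbar_c pi b c)
  (a eta_inf : R) (ha : 0 < a) (heta_inf : 0 < eta_inf)
  (heta_a : eta_inf * a <= 1 / 2)
  (hA1 : forall (c : 'I_N) (eta : R) (u : 'cV[R]_d), 0 < eta < eta_inf ->
     (Lnorm (pi c) 2%:E (fun z => (enorm ((1%:M - eta *: A c z) *m u))%:E)
        <= ((1 - eta * a) * enorm u)%:E)%E)
  (eta : nat -> R) (H : nat -> nat)
  (heta : forall s, (1 <= s)%N -> 0 < eta s <= eta_inf)
  (Zs : 'I_N -> nat -> nat -> Omega -> Z)
  (mZs : forall c t h, measurable_fun setT (Zs c t h))
  (hlaw : forall c t h, (1 <= t)%N -> (1 <= h <= H t)%N ->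
     forall B : set Z, measurable B -> P (Zs c t h @^-1` B) = pi c B)
  (hindep : mutually_independent P
     [set i : 'I_N * nat * nat | (1 <= i.1.2)%N /\ (1 <= i.2 <= H i.1.2)%N]
     (fun i => Zs i.1.1 i.1.2 i.2))
  (heps_bd : exists Ceps : R, forall c z, enorm (epsf pi A b thc c z) <= Ceps)
  (hCA : exists CA : R, forall c z,
     opnorm (A c z) <= CA /\ opnorm (Atil pi A c z) <= CA)
  (theta0 : 'cV[R]_d).

(** * Boundedness and centring of the data of each agent *)

Lemma epsfE c z : epsf pi A b thc c z = A c z *m thc c - b c z.
Proof.
rewrite /epsf /Atil /btil mulmxBl hthc.
by apply/colP => i; rewrite !mxE; ring.
Qed.

Lemma bmv_A c : bmv (A c).
Proof.
move=> i j; split; first exact: mA.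
have [CA hC] := hCA; exists CA => z.
by apply: (le_trans (norm_le_opnorm _ _ _)); have [] := hC c z.
Qed.

Lemma bmv_Atil c : bmv (Atil pi A c).
Proof. by apply: bmvB; [exact: bmv_A|exact: bmv_cst]. Qed.

Lemma bmv_eps c : bmv (epsf pi A b thc c).
Proof.
move=> i j; split; last first.
  have [C hC] := heps_bd; exists C => z.
  by rewrite ord1; apply: (le_trans (norm_le_enorm _ _)).
under eq_fun do rewrite epsfE !mxE.
apply: measurable_funB => //.
have := bmvM (bmv_A c) (bmv_cst (T := Z) (thc c)).
by move=> /(_ i j)[]; under eq_fun do rewrite mxE.
Qed.

Lemma bE c z : b c z = A c z *m thc c - epsf pi A b thc c z.
Proof. by rewrite epsfE; apply/colP => i; rewrite !mxE; ring. Qed.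

Lemma bmv_b c : bmv (b c).
Proof.
rewrite (funext (bE c)); apply: bmvB; last exact: bmv_eps.
by apply: bmvM; [exact: bmv_A|exact: bmv_cst].
Qed.

Lemma mean_eps c : mean_mx (pi c) (epsf pi A b thc c) = 0.
Proof.
rewrite (_ : epsf pi A b thc c = fun z => A c z *m thc c + (-1) *: b c z); last first.
  by apply/funext => z; rewrite epsfE scaleN1r.
have bb : bmv (fun z => -1 *: b c z) by apply: bmvZ; exact: bmv_b.
have bA : bmv (fun z => A c z *m thc c).
  by apply: bmvM; [exact: bmv_A|exact: bmv_cst].
rewrite mean_mxD// mean_mulmx; last exact: bmv_A.
rewrite mean_mxZ; last exact: bmv_b.
by rewrite -/(Abar_c pi A c) -/(bbar_c pi b c) hthc scaleN1r subrr.
Qed.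

Lemma mean_Atil c : mean_mx (pi c) (Atil pi A c) = 0.
Proof.
rewrite (_ : Atil pi A c = fun z => A c z + (-1) *: Abar_c pi A c); last first.
  by apply/funext => z; rewrite scaleN1r.
rewrite mean_mxD; [|exact: bmv_A|exact: bmv_cst].
by rewrite mean_mx_cst scaleN1r subrr.
Qed.

(** * One stochastic step: contraction and noise level *)

Definition step c e z : 'M[R]_d := 1%:M - e *: A c z.

Lemma bmv_step c e : bmv (step c e).
Proof. by apply: bmvB; [exact: bmv_cst|apply: bmvZ; exact: bmv_A]. Qed.

Lemma bmv_stepM c e (u : 'cV[R]_d) : bmv (fun z => step c e z *m u).
Proof. by apply: bmvM; [exact: bmv_step|exact: bmv_cst]. Qed.

(* A1(2) only covers step sizes below [eta_inf]; after division by [e] the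
   inequality is affine in [e], hence it extends to [e = eta_inf]. *)
Lemma msq_step c e (u : 'cV[R]_d) : 0 < e <= eta_inf ->
  msq (pi c) (fun z => step c e z *m u) <= (1 - e * a) ^+ 2 * enorm u ^+ 2.
Proof.
have lt_case e' : 0 < e' < eta_inf ->
    msq (pi c) (fun z => step c e' z *m u) <= (1 - e' * a) ^+ 2 * enorm u ^+ 2.
  move=> e'b; have := hA1 c u e'b; rewrite (Lnorm2_msq _ (bmv_stepM c e' u)) lee_fin => h.
  rewrite -exprMn -(sqr_sqrtr (msq_ge0 _ _)) lerXn2r ?nnegrE ?sqrtr_ge0//.
  exact: le_trans h.
move=> /andP[e0]; rewrite le_eqVlt => /orP[/eqP ->|el]; last by rewrite lt_case// e0.
have bu : bmv (fun _ : Z => u) by exact: bmv_cst.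
have bAu : bmv (fun z => A c z *m u) by apply: bmvM => //; exact: bmv_A.
pose n := enorm u ^+ 2; pose q := msq (pi c) (fun z => A c z *m u).
pose p := Ex (pi c) (fun z => dot u (A c z *m u)).
have E e' : msq (pi c) (fun z => step c e' z *m u) = n + 2 * - e' * p + (- e') ^+ 2 * q.
  rewrite /n -(msq_cst (pi c)) /p /q msq_quad//; congr (msq _ _).
  by apply/funext => z; rewrite /step mulmxBl mul1mx -scalemxAl scaleNr.
pose s := q - a ^+ 2 * n; pose f := 2 * a * n - 2 * p.
have lt_case' e' : 0 < e' < eta_inf -> f + e' * s <= 0.
  move=> e'b; have := lt_case e' e'b; rewrite E -subr_le0 -/n.
  have -> : n + 2 * - e' * p + (- e') ^+ 2 * q - (1 - e' * a) ^+ 2 * n =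
    e' * (f + e' * s) by rewrite /f /s; ring.
  by rewrite pmulr_rle0//; case/andP: e'b.
rewrite E -/n -subr_le0.
have -> : n + 2 * - eta_inf * p + (- eta_inf) ^+ 2 * q - (1 - eta_inf * a) ^+ 2 * n =
  eta_inf * (f + eta_inf * s) by rewrite /f /s; ring.
rewrite pmulr_rle0// leNgt; apply/negP => F0; set F := f + eta_inf * s in F0.
have [s0|s0] := leP s 0.
  have := lt_case' (eta_inf / 2); rewrite divr_gt0//= ltr_pdivrMr// ltr_pMr// ltr1n.
  move=> /(_ isT); apply/negP; rewrite -ltNge.
  have -> : f + eta_inf / 2 * s = F - eta_inf * s / 2 by rewrite /F; field.
  by rewrite subr_gt0; apply: le_lt_trans F0; rewrite pmulr_lle0 ?invr_gt0// pmulr_rle0.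
have D0 : 0 < F + eta_inf * s by rewrite addr_gt0// mulr_gt0.
(* Moving from [eta_inf] down to [e'] lowers the affine function by [(eta_inf - e') * s]. With this
   [e'] the loss is the proper fraction [eta_inf * s / (F + eta_inf * s)] of [F], so the value stays
   positive. *)
pose e' := eta_inf * (eta_inf * s / (F + eta_inf * s)).
have := lt_case' e'; rewrite /e' mulr_gt0 ?divr_gt0 ?mulr_gt0//=.
rewrite gtr_pMr// ltr_pdivrMr// mul1r ltrDr F0 => /(_ isT); apply/negP; rewrite -ltNge.
have -> : f + eta_inf * (eta_inf * s / (F + eta_inf * s)) * s =
    F ^+ 2 / (F + eta_inf * s).
  by rewrite (_ : f = F - eta_inf * s); [field; rewrite gt_eqF|rewrite /F; ring].
by rewrite divr_gt0// exprn_gt0.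
Qed.

Lemma contraction_ge0 e : 0 < e <= eta_inf -> 0 <= 1 - e * a.
Proof.
move=> /andP[e0 el]; rewrite subr_ge0; apply: (@le_trans _ _ (eta_inf * a)).
  by rewrite ler_pM2r.
by apply: (le_trans heta_a); lra.
Qed.

Lemma contraction_le1 e : 0 < e <= eta_inf -> 1 - e * a <= 1.
Proof. by move=> /andP[e0 _]; rewrite gerBl mulr_ge0// ltW. Qed.

(** Jensen's inequality carries [msq_step] over from the random step to its mean. *)
Lemma enorm_mean_step c e (u : 'cV[R]_d) : 0 < e <= eta_inf ->
  enorm ((1%:M - e *: Abar_c pi A c) *m u) <= enorm u.
Proof.
move=> eb; have := enorm_mean_mx (pi c) (bmv_stepM c e u).
rewrite mean_mulmx; last exact: bmv_step.
have -> : mean_mx (pi c) (step c e) = 1%:M - e *: Abar_c pi A c.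
  rewrite (_ : step c e = fun z => 1%:M + (- e) *: A c z); last first.
    by apply/funext => z; rewrite scaleNr.
  have bA := bmv_A c.
  rewrite mean_mxD; [|exact: bmv_cst|exact: bmvZ].
  by rewrite mean_mx_cst mean_mxZ// scaleNr.
move=> h; rewrite -(@ler_pXn2r _ 2) ?nnegrE ?enorm_ge0//.
apply: (le_trans h); apply: (le_trans (msq_step c u eb)).
rewrite ler_piMl ?sqr_ge0// expr_le1// ?contraction_le1//.
exact: contraction_ge0.
Qed.

(** The left side is the quadratic form of [SigmaA] at [v]; Cauchy-Schwarz bounds it. *)
Lemma msq_Atil c (v : 'cV[R]_d) :
  msq (pi c) (fun z => Atil pi A c z *m v) <= opnorm (SigmaA pi A c) * enorm v ^+ 2.
Proof.
have bG : bmv (fun z => (Atil pi A c z)^T *m Atil pi A c z).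
  by apply: bmvM; [apply: bmv_tr|]; exact: bmv_Atil.
rewrite msqE; under eq_fun do rewrite dot_tr dotC mulmxA.
rewrite Ex_dotl; last by apply: bmvM => //; exact: bmv_cst.
rewrite mean_mulmx// -/(SigmaA pi A c).
apply: (le_trans (dot_cauchy _ _)); rewrite expr2 mulrA.
by rewrite ler_wpM2r ?enorm_ge0// enorm_mulmx.
Qed.

Lemma msq_eps c : msq (pi c) (epsf pi A b thc c) = \tr (Sigmaeps pi A b thc c).
Proof.
have be := bmv_eps c.
rewrite msqE Ex_sum; last by move=> i; exact: bmfM.
apply: eq_bigr => i _; rewrite mxE; congr (Rintegral _ _ _); apply/funext => z.
by rewrite [RHS]mxE big_ord1 [X in _ = _ * X]mxE.
Qed.

(** An L2 bound for the noise of a single local step, before scaling by the step size: additive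
    noise plus heterogeneity noise, combined by Minkowski's inequality in [msq_noise]. *)
Definition noise c : R :=
  Num.sqrt (\tr (Sigmaeps pi A b thc c)) +
  Num.sqrt (opnorm (SigmaA pi A c) * enorm (thc c - ths) ^+ 2).

Lemma msq_noise c (v : 'cV[R]_d) : enorm v <= enorm (thc c - ths) ->
  msq (pi c) (fun z => Atil pi A c z *m v - epsf pi A b thc c z) <= noise c ^+ 2.
Proof.
move=> hv; have be := bmv_eps c.
have bA : bmv (fun z => Atil pi A c z *m v).
  by apply: bmvM; [exact: bmv_Atil|exact: bmv_cst].
have beN : bmv (fun z => (-1) *: epsf pi A b thc c z) by exact: bmvZ.
rewrite -(sqr_sqrtr (msq_ge0 _ _)) lerXn2r ?nnegrE ?addr_ge0 ?sqrtr_ge0//.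
rewrite (_ : (fun z => _) =
    fun z => Atil pi A c z *m v + (-1) *: epsf pi A b thc c z); last first.
  by apply/funext => z; rewrite scaleN1r.
apply: (le_trans (msq_minkowski (pi c) bA beN)); rewrite addrC; apply: lerD.
  by rewrite msqZ// msq_eps sqrrN expr1n mul1r.
apply: ler_wsqrtr; apply: (le_trans (msq_Atil c v)).
by rewrite ler_wpM2l ?opnorm_ge0// lerXn2r ?nnegrE ?enorm_ge0.
Qed.

(** * The deterministic bias of one agent *)

Definition drift c : 'cV[R]_d := Abar_c pi A c *m (thc c - ths).

(** The error, relative to [ths], of the noise-free local iteration started at [ths]. Its recursion
    has [thc c - ths] as a fixed point. *)
Fixpoint bias c e h : 'cV[R]_d :=
  if h is h'.+1 then (1%:M - e *: Abar_c pi A c) *m bias c e h' + e *: drift c else 0.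

(** The distance to the fixed point follows the homogeneous recursion, which is nonexpansive. This
    makes the bound [noise c] uniform over the local steps. *)
Lemma enorm_residual c e h : 0 < e <= eta_inf ->
  enorm (thc c - ths - bias c e h) <= enorm (thc c - ths).
Proof.
move=> eb; elim: h => [|h IH]; first by rewrite subr0.
apply: le_trans IH; apply: le_trans (enorm_mean_step c _ eb).
rewrite le_eqVlt; apply/orP; left; apply/eqP; congr enorm.
rewrite /= /drift !mulmxBl !mulmxBr !mul1mx -!scalemxAl.
by apply/colP => i; rewrite !mxE; ring.
Qed.

Lemma enorm_bias c e h : 0 < e <= eta_inf ->
  enorm (bias c e h) <= e * h%:R * enorm (drift c).
Proof.
move=> eb; have e0 : 0 < e by case/andP: eb.
elim: h => [|h IH]; first by rewrite enorm0 mulr0 mul0r.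
apply: (le_trans (enormD _ _)); rewrite enormZ gtr0_norm//.
rewrite -natr1 mulrDr mulr1 mulrDl lerD2r.
exact: le_trans (enorm_mean_step c _ eb) IH.
Qed.

(** * Averages over the agents and cancellation of the biases *)

Definition avg m n (F : 'I_N -> 'M[R]_(m, n)) : 'M[R]_(m, n) :=
  (N%:R)^-1 *: \sum_c F c.

Let N0 : 0 < N%:R :> R. Proof. by rewrite ltr0n. Qed.

Lemma avg_cst m n (M : 'M[R]_(m, n)) : avg (fun=> M) = M.
Proof.
rewrite /avg sumr_const card_ord -[M *+ N]scaler_nat scalerA mulVf ?scale1r//.
by rewrite gt_eqF.
Qed.

Lemma avgD m n (F G : 'I_N -> 'M[R]_(m, n)) :
  avg (fun c => F c + G c) = avg F + avg G.
Proof. by rewrite /avg big_split scalerDr. Qed.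

Lemma avgZ m n k (F : 'I_N -> 'M[R]_(m, n)) : avg (fun c => k *: F c) = k *: avg F.
Proof. by rewrite /avg -scaler_sumr !scalerA mulrC. Qed.

Lemma avgB m n (F G : 'I_N -> 'M[R]_(m, n)) :
  avg (fun c => F c - G c) = avg F - avg G.
Proof. by rewrite /avg sumrB scalerBr. Qed.

Lemma avg_mulmx m n p (F : 'I_N -> 'M[R]_(m, n)) (M : 'M[R]_(n, p)) :
  avg (fun c => F c *m M) = avg F *m M.
Proof. by rewrite /avg -scalemxAl mulmx_suml. Qed.

Lemma avg_mulmxr m n p (M : 'M[R]_(m, n)) (F : 'I_N -> 'M[R]_(n, p)) :
  avg (fun c => M *m F c) = M *m avg F.
Proof. by rewrite /avg -scalemxAr mulmx_sumr. Qed.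

Lemma enorm_avg (F : 'I_N -> 'cV[R]_d) :
  enorm (avg F) <= (N%:R)^-1 * \sum_c enorm (F c).
Proof.
rewrite enormZ ger0_norm ?invr_ge0 ?(ltW N0)//.
by rewrite ler_wpM2l ?invr_ge0 ?(ltW N0)// enorm_sum.
Qed.

(** Convexity of the square, obtained from Cauchy-Schwarz against the constant 1. *)
Lemma enorm_avg_sqr (F : 'I_N -> 'cV[R]_d) :
  enorm (avg F) ^+ 2 <= (N%:R)^-1 * \sum_c enorm (F c) ^+ 2.
Proof.
have n0 := ltW N0; have i0 : 0 <= (N%:R)^-1 :> R by rewrite invr_ge0.
have s0 : 0 <= \sum_c enorm (F c) by apply: sumr_ge0 => c _; exact: enorm_ge0.
have q0 : 0 <= \sum_c enorm (F c) ^+ 2 by apply: sumr_ge0 => c _; exact: sqr_ge0.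
have h : (\sum_c enorm (F c)) ^+ 2 <= N%:R * \sum_c enorm (F c) ^+ 2.
  have := sum_cauchy (fun c => enorm (F c)) (fun=> 1).
  under eq_bigr do rewrite mulr1.
  rewrite expr1n sumr_const card_ord => cs.
  rewrite mulrC -[X in X * N%:R]sqr_sqrtr// -[X in _ ^+ 2 * X]sqr_sqrtr// -exprMn.
  by rewrite lerXn2r ?nnegrE ?mulr_ge0 ?sqrtr_ge0.
apply: (@le_trans _ _ (((N%:R)^-1 * \sum_c enorm (F c)) ^+ 2)).
  by rewrite lerXn2r ?nnegrE ?enorm_ge0 ?mulr_ge0// enorm_avg.
rewrite exprMn expr2 -mulrA ler_wpM2l//.
by rewrite mulrC ler_pdivrMr// mulrC.
Qed.

Lemma avg_drift : avg drift = 0.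
Proof.
have E : avg drift = avg (fun c => Abar_c pi A c *m thc c) - Abar pi A *m ths.
  rewrite -[Abar pi A]/(avg (Abar_c pi A)) -avg_mulmx -avgB.
  by congr avg; apply/funext => c; rewrite -mulmxBr.
by rewrite E hths (funext hthc) subrr.
Qed.

Lemma zeta12 :
  (N%:R)^-1 * \sum_c opnorm (Abar_c pi A c - Abar pi A) * enorm (drift c) <=
  zeta1 pi A thc ths * zeta2 pi A.
Proof.
have n0 := ltW N0; have i0 : 0 <= (N%:R)^-1 :> R by rewrite invr_ge0.
rewrite /zeta1 /zeta2 !sqrtrM// mulrACA -expr2 sqr_sqrtr//.
rewrite ler_wpM2l// mulrC; exact: sum_cauchy.
Qed.

(* As the drifts average to zero, the averaged bias only accumulates the
   deviations [Abar_c - Abar] applied to the local biases, of order [e * h]. *)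
Lemma enorm_avg_bias e h : 0 < e <= eta_inf ->
  enorm (avg (fun c => bias c e h)) <=
  e ^+ 2 * h%:R ^+ 2 * (zeta1 pi A thc ths * zeta2 pi A).
Proof.
move=> eb; have e0 : 0 < e by case/andP: eb.
have z0 : 0 <= zeta1 pi A thc ths * zeta2 pi A by rewrite mulr_ge0 ?sqrtr_ge0.
elim: h => [|h IH].
  by rewrite avg_cst enorm0 mulr_ge0// mulr_ge0// ?sqr_ge0.
set B := avg (fun c => bias c e h) in IH.
have E : avg (fun c => bias c e h.+1) =
    avg (fun c => (1%:M - e *: Abar_c pi A c) *m B) +
    (- e) *: (avg (fun c => (Abar_c pi A c - Abar pi A) *m bias c e h)).
  have -> : avg (fun c => bias c e h.+1) =
      B - e *: avg (fun c => Abar_c pi A c *m bias c e h).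
    rewrite -scaleNr -avgZ -avgD.
    transitivity (avg (fun c => bias c e h + - e *: (Abar_c pi A c *m bias c e h)) +
      e *: avg drift); last by rewrite avg_drift scaler0 addr0.
    rewrite -avgZ -avgD; congr avg; apply/funext => c /=.
    by rewrite mulmxBl mul1mx -scalemxAl scaleNr.
  rewrite avg_mulmx.
  have -> : avg (fun c => 1%:M - e *: Abar_c pi A c) = 1%:M - e *: Abar pi A.
    by rewrite -[Abar pi A]/(avg (Abar_c pi A)) -avgZ -[in RHS](avg_cst 1%:M) -avgB.
  have -> : avg (fun c => (Abar_c pi A c - Abar pi A) *m bias c e h) =
      avg (fun c => Abar_c pi A c *m bias c e h) - Abar pi A *m B.
    rewrite -avg_mulmxr -avgB.
    by congr avg; apply/funext => c; rewrite mulmxBl.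
  rewrite mulmxBl mul1mx -scalemxAl.
  by apply/colP => i; rewrite !mxE; ring.
rewrite E; apply: (le_trans (enormD _ _)).
(* The matrix is kept as an average because [enorm_mean_step] speaks of each agent separately. *)
have h1 : enorm (avg (fun c => (1%:M - e *: Abar_c pi A c) *m B)) <= enorm B.
  apply: (le_trans (enorm_avg _)); rewrite mulrC ler_pdivrMr//.
  apply: (@le_trans _ _ (\sum_(c < N) enorm B)).
    by apply: ler_sum => c _; exact: enorm_mean_step.
  by rewrite sumr_const card_ord mulr_natr.
have h2 : enorm (avg (fun c => (Abar_c pi A c - Abar pi A) *m bias c e h)) <=
    e * h%:R * (zeta1 pi A thc ths * zeta2 pi A).
  apply: (le_trans (enorm_avg _)).
  apply: (@le_trans _ _ (e * h%:R * ((N%:R)^-1 *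
      \sum_c opnorm (Abar_c pi A c - Abar pi A) * enorm (drift c)))); last first.
    by rewrite ler_wpM2l ?zeta12// mulr_ge0// ltW.
  rewrite mulrCA ler_wpM2l ?invr_ge0 ?(ltW N0)// mulr_sumr.
  apply: ler_sum => c _; apply: (le_trans (enorm_mulmx _ _)).
  by rewrite mulrCA ler_wpM2l ?opnorm_ge0// enorm_bias.
apply: (le_trans (lerD (le_trans h1 IH)
  (_ : _ <= e * (e * h%:R * (zeta1 pi A thc ths * zeta2 pi A))))).
  by rewrite enormZ normrN gtr0_norm// ler_wpM2l// ltW.
(* The induction closes because [h ^ 2 + h <= (h + 1) ^ 2]. *)
set z := zeta1 _ _ _ _ * zeta2 _ _ in z0 *.
have -> : e ^+ 2 * h%:R ^+ 2 * z + e * (e * h%:R * z) =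
    e ^+ 2 * z * (h%:R ^+ 2 + h%:R) by ring.
have -> : e ^+ 2 * h.+1%:R ^+ 2 * z = e ^+ 2 * z * h.+1%:R ^+ 2 by ring.
apply: ler_wpM2l; first by apply: mulr_ge0 => //; exact: sqr_ge0.
have : 0 <= h%:R :> R by exact: ler0n.
by rewrite -natr1; nra.
Qed.

(** * Index sets of the samples used by an agent, a round and the past *)

Notation idx := ('I_N * nat * nat)%type.
Definition sample (i : idx) : Omega -> Z := Zs i.1.1 i.1.2 i.2.
Definition Idx : set idx := [set i | (1 <= i.1.2)%N /\ (1 <= i.2 <= H i.1.2)%N].
Definition local_idx c t h : set idx :=
  [set i | [/\ i.1.1 = c, i.1.2 = t & (1 <= i.2 <= h)%N]].
Definition round_idx t : set idx := [set i | i.1.2 = t /\ (1 <= i.2 <= H t)%N].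
Definition past_idx t : set idx :=
  [set i | (1 <= i.1.2 <= t)%N /\ (1 <= i.2 <= H i.1.2)%N].

Local Notation gsample := (@gen_mx R dO dZ Omega Z idx sample).

Let mX i : measurable_fun setT (sample i). Proof. exact: mZs. Qed.

Lemma local_sub_Idx c t h : (1 <= t)%N -> (h <= H t)%N -> local_idx c t h `<=` Idx.
Proof.
move=> t1 hH i [_ it /andP[i1 ih]]; split; rewrite it// i1/=.
exact: leq_trans ih hH.
Qed.

Lemma local_sub_round c t : local_idx c t (H t) `<=` round_idx t.
Proof. by move=> i []. Qed.

Lemma round_sub_Idx t : (1 <= t)%N -> round_idx t `<=` Idx.
Proof. by move=> t1 i [it ih]; split; rewrite it. Qed.

Lemma past_sub_Idx t : past_idx t `<=` Idx.
Proof. by move=> i [/andP[i1 _] ih]. Qed.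

Lemma round_sub_past t : round_idx t.+1 `<=` past_idx t.+1.
Proof. by move=> i [it ih]; split; rewrite it//= leqnn. Qed.

Lemma past_subS t : past_idx t `<=` past_idx t.+1.
Proof. by move=> i [/andP[i1 it] ih]; split=> //; rewrite i1/= leqW. Qed.

Lemma round_past_disjoint t : round_idx t.+1 `&` past_idx t `<=` set0.
Proof. by move=> i [[it _] [/andP[_ +] _]]; rewrite it ltnn. Qed.

Lemma local_sub c t h : local_idx c t h `<=` local_idx c t h.+1.
Proof. by move=> i [ic it /andP[i1 ih]]; split=> //; rewrite i1 leqW. Qed.

Lemma local_new c t h : local_idx c t h.+1 (c, t, h.+1).
Proof. by split=> //=. Qed.

Lemma local_old c t h : ~ local_idx c t h (c, t, h.+1).
Proof. by case=> _ _ /=; rewrite ltnn. Qed.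

(** * Decomposition of the local error within a round *)

Definition A_at c t h w : 'M[R]_d := step c (eta t) (Zs c t h w).

Fixpoint local_prod c t h w : 'M[R]_d :=
  if h is h'.+1 then A_at c t h w *m local_prod c t h' w else 1%:M.

(** The noise is taken around the deterministic [bias], not around the random iterate, so it is a
    centred function of one sample. Here [h] counts the steps already made: the sample fed to it has
    index [h.+1]. *)
Definition noise_at c t h z : 'cV[R]_d :=
  Atil pi A c z *m (thc c - ths - bias c (eta t) h) - epsf pi A b thc c z.

Fixpoint fluct c t h w : 'cV[R]_d :=
  if h is h'.+1
  then A_at c t h w *m fluct c t h' w + eta t *: noise_at c t h' (Zs c t h w)
  else 0.

Lemma bmv_noise c t h : bmv (noise_at c t h).
Proof.
apply: bmvB; last exact: bmv_eps.
by apply: bmvM; [exact: bmv_Atil|exact: bmv_cst].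
Qed.

(** In each step [A c z] is split as [Abar_c + Atil] where it acts on [bias] and on [thc c - ths].
    The mean part continues the recursion of [bias], the centred part goes into [noise_at], and the
    other two terms keep the full random step. *)
Lemma local_iterE c t h th w :
  local_iter (eta t) (A c) (b c) (fun h => Zs c t h w) th h - ths =
  local_prod c t h w *m (th - ths) + bias c (eta t) h + fluct c t h w.
Proof.
elim: h => [|h IH]; first by rewrite /= mul1mx !addr0.
rewrite /=; set y := local_iter _ _ _ _ _ _ in IH *.
have -> : y = ths + (local_prod c t h w *m (th - ths) + bias c (eta t) h + fluct c t h w).
  by rewrite -IH addrC subrK.
rewrite /noise_at /A_at /step bE; set z := Zs c t h.+1 w.
rewrite -mulmxA /Atil /drift; set G := local_prod c t h w *m _; set r := bias _ _ _.
set f := fluct _ _ _ _.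
rewrite !(mulmxBl, mulmxBr, mulmxDl, mulmxDr, mul1mx, mulNmx) -!scalemxAl.
by apply/colP => i; rewrite !mxE; ring.
Qed.

Lemma gen_mx_A_at (S : set idx) c t h : S (c, t, h) -> gsample S (A_at c t h).
Proof. by move=> Si; apply: (gen_mx_var sample Si); exact: bmv_step. Qed.

Lemma gen_mx_local_prod c t h : gsample (local_idx c t h) (local_prod c t h).
Proof.
elim: h => [|h IH]; first exact: gen_mx_cst.
apply: gen_mxM; first by apply: gen_mx_A_at; exact: local_new.
exact: gen_mx_sub (@local_sub c t h) IH.
Qed.

Lemma gen_mx_fluct c t h : gsample (local_idx c t h) (fluct c t h).
Proof.
elim: h => [|h IH]; first exact: gen_mx_cst.
apply: gen_mxD.
  apply: gen_mxM; first by apply: gen_mx_A_at; exact: local_new.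
  exact: gen_mx_sub (@local_sub c t h) IH.
apply: gen_mxZ; apply: (gen_mx_var sample (local_new c t h)); exact: bmv_noise.
Qed.

Lemma lawX c t h : (1 <= t)%N -> (h < H t)%N ->
  forall B, measurable B -> P (sample (c, t, h.+1) @^-1` B) = pi c B.
Proof. by move=> t1 hH B mB; rewrite hlaw. Qed.

Lemma mean_noise c t h : mean_mx (pi c) (noise_at c t h) = 0.
Proof.
rewrite (_ : noise_at c t h = fun z => Atil pi A c z *m (thc c - ths - bias c (eta t) h)
   + (-1) *: epsf pi A b thc c z); last first.
  by apply/funext => z; rewrite scaleN1r.
have bA := bmv_Atil c; have be := bmv_eps c.
rewrite mean_mxD; [|by apply: bmvM => //; exact: bmv_cst|exact: bmvZ].
by rewrite mean_mxZ// mean_mulmx// mean_Atil mean_eps mul0mx scaler0 addr0.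
Qed.

Lemma Idx_next c t h : (1 <= t)%N -> (h < H t)%N -> Idx (c, t, h.+1).
Proof. by move=> t1 hH; split. Qed.

Lemma mean_fluct c t h : (1 <= t)%N -> (h <= H t)%N -> mean_mx P (fluct c t h) = 0.
Proof.
move=> t1; elim: h => [|h IH] hH; first exact: mean_mx_cst.
have gA : gsample [set (c, t, h.+1)] (A_at c t h.+1) by exact: gen_mx_A_at.
have gf := gen_mx_fluct c t h.
have gn : gsample [set (c, t, h.+1)] (fun w => noise_at c t h (Zs c t h.+1 w)).
  apply: (gen_mx_var sample (erefl _ : [set (c, t, h.+1)] (c, t, h.+1))).
  exact: bmv_noise.
have bn := gen_mx_bmv mX gn.
rewrite /= mean_mxD; last 2 first.
- by apply: bmvM; [exact: (gen_mx_bmv mX gA)|exact: (gen_mx_bmv mX gf)].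
- exact: bmvZ.
rewrite (mean_mulmx_indep mX hindep _ _ _ gA gf); last first.
- by move=> i [-> /local_old].
- exact: local_sub_Idx t1 (ltnW hH).
- by move=> i ->; exact: Idx_next.
rewrite IH ?(ltnW hH)// mulmx0 add0r mean_mxZ//.
rewrite (mean_mx_law mX (lawX c t1 hH) (bmv_noise c t h)).
by rewrite mean_noise scaler0.
Qed.

(** The new noise is orthogonal to the propagated fluctuation, and a step does not increase second
    moments, so every step adds at most [eta t ^+ 2 * noise c ^+ 2]. *)
Lemma msq_fluct c t h : (1 <= t)%N -> (h <= H t)%N ->
  msq P (fluct c t h) <= h%:R * (eta t ^+ 2 * noise c ^+ 2).
Proof.
move=> t1; have et := heta t1; elim: h => [|h IH] hH.
  by rewrite msq_cst enorm0 expr0n mul0r.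
have gA : gsample [set (c, t, h.+1)] (A_at c t h.+1) by exact: gen_mx_A_at.
have gf := gen_mx_fluct c t h.
have gn : gsample [set (c, t, h.+1)] (fun w => eta t *: noise_at c t h (Zs c t h.+1 w)).
  apply: gen_mxZ.
  apply: (gen_mx_var sample (erefl _ : [set (c, t, h.+1)] (c, t, h.+1))).
  exact: bmv_noise.
have [bA [bf bn]] := (gen_mx_bmv mX gA, (gen_mx_bmv mX gf, gen_mx_bmv mX gn)).
rewrite /= msqD//; last exact: bmvM.
have fI : local_idx c t h `<=` Idx by exact: local_sub_Idx t1 (ltnW hH).
have sI : [set (c, t, h.+1)] `<=` Idx by move=> i ->; exact: Idx_next.
(* [A_at] and the new noise share a sample. Transposing [A_at] to the other side leaves
   [fluct c t h] alone, which is centred and independent of that sample. *)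
have -> : Ex P (fun w => dot (A_at c t h.+1 w *m fluct c t h w)
    (eta t *: noise_at c t h (Zs c t h.+1 w))) = 0.
  under eq_fun do rewrite dot_tr.
  apply: (Ex_dot_indep0 mX hindep fI sI _ gf).
  - by move=> i [il ii]; rewrite ii in il; case: (local_old il).
  - by apply: gen_mxM => //; exact: gen_mx_tr.
  - by rewrite mean_fluct// ltnW.
rewrite mulr0 addr0 -natr1 mulrDl mul1r; apply: lerD.
  apply: le_trans (IH (ltnW hH)).
  rewrite -[leRHS]mul1r.
  apply: (msq_mulmx_law mX hindep (Idx_next c t1 hH) (lawX c t1 hH) fI
    (@local_old c t h) (bmv_step c (eta t)) gf) => u.
  apply: (le_trans (msq_step c u et)); rewrite ler_wpM2r ?sqr_ge0//.
  by rewrite expr_le1// ?contraction_le1// contraction_ge0.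
rewrite msqZ; last first.
  by move=> i j; exact: (bmf_comp (mX (c, t, h.+1)) (bmv_noise c t h i j)).
rewrite ler_wpM2l ?sqr_ge0// (msq_law mX (lawX c t1 hH) (bmv_noise c t h)).
exact: msq_noise (enorm_residual c h et).
Qed.

Lemma msq_local_prod S (W : Omega -> 'cV[R]_d) c t h : (1 <= t)%N -> (h <= H t)%N ->
  S `<=` Idx -> S `&` round_idx t `<=` set0 -> gsample S W ->
  msq P (fun w => local_prod c t h w *m W w) <= ((1 - eta t * a) ^+ 2) ^+ h * msq P W.
Proof.
move=> t1 + SI Sr gW; have et := heta t1; elim: h => [|h IH] hH.
  by rewrite /= mul1r; under eq_fun do rewrite mul1mx.
rewrite /=; under eq_fun do rewrite -mulmxA.
rewrite exprS -mulrA.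
pose S' := S `|` local_idx c t h.
have S'I : S' `<=` Idx.
  by move=> i [/SI//|]; exact: local_sub_Idx t1 (ltnW hH) _.
have S'n : ~ S' (c, t, h.+1).
  by move=> [Si|]; [apply: (Sr (c, t, h.+1)); split|exact: local_old].
have gGW : gsample S' (fun w => local_prod c t h w *m W w).
  apply: gen_mxM; first by apply: gen_mx_sub (gen_mx_local_prod c t h) => i; right.
  by apply: gen_mx_sub gW => i; left.
apply: (@le_trans _ _ ((1 - eta t * a) ^+ 2 * msq P (fun w => local_prod c t h w *m W w))).
  apply: (msq_mulmx_law mX hindep (Idx_next c t1 hH) (lawX c t1 hH) S'I S'n
    (bmv_step c (eta t)) gGW) => u.
  exact: msq_step.
by rewrite ler_wpM2l ?sqr_ge0// IH// ltnW.
Qed.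

(** * One communication round *)

Definition avg_prod t w : 'M[R]_d := avg (fun c => local_prod c t (H t) w).
Definition avg_bias t : 'cV[R]_d := avg (fun c => bias c (eta t) (H t)).
Definition avg_fluct t w : 'cV[R]_d := avg (fun c => fluct c t (H t) w).

Lemma gen_mx_avg (S : set idx) m n (F : 'I_N -> Omega -> 'M[R]_(m, n)) :
  (forall c, gsample S (F c)) -> gsample S (fun w => avg (fun c => F c w)).
Proof. by move=> gF; apply: gen_mxZ; exact: gen_mx_sum. Qed.

Lemma gen_mx_avg_prod t : gsample (round_idx t) (avg_prod t).
Proof.
apply: gen_mx_avg => c; apply: gen_mx_sub (gen_mx_local_prod _ _ _).
exact: local_sub_round.
Qed.

Lemma gen_mx_avg_fluct t : gsample (round_idx t) (avg_fluct t).
Proof.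
apply: gen_mx_avg => c; apply: gen_mx_sub (gen_mx_fluct _ _ _).
exact: local_sub_round.
Qed.

Lemma mean_avg (F : 'I_N -> Omega -> 'cV[R]_d) : (forall c, bmv (F c)) ->
  mean_mx P (fun w => avg (fun c => F c w)) = avg (fun c => mean_mx P (F c)).
Proof.
move=> bF; have bs : bmv (fun w => \sum_c F c w).
  by move=> i j; under eq_fun do rewrite summxE; apply: bmf_sum => c; exact: bF.
rewrite /avg mean_mxZ//; congr (_ *: _).
apply/matrixP => i j; rewrite mxE -/(Ex P _) summxE.
under eq_fun do rewrite summxE.
by rewrite Ex_sum => [|c]; [apply: eq_bigr => c _; rewrite mxE|exact: bF].
Qed.

Lemma mean_avg_fluct t : (1 <= t)%N -> mean_mx P (avg_fluct t) = 0.
Proof.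
move=> t1; rewrite mean_avg => [|c]; last exact: (gen_mx_bmv mX (gen_mx_fluct c t (H t))).
rewrite -[RHS](avg_cst 0); congr avg; apply/funext => c.
by rewrite mean_fluct.
Qed.

Lemma msq_avg_prod S (W : Omega -> 'cV[R]_d) t : (1 <= t)%N ->
  S `<=` Idx -> S `&` round_idx t `<=` set0 -> gsample S W ->
  msq P (fun w => avg_prod t w *m W w) <= ((1 - eta t * a) ^+ H t) ^+ 2 * msq P W.
Proof.
move=> t1 SI Sr gW; have bW := gen_mx_bmv mX gW.
have bGW c : bmv (fun w => local_prod c t (H t) w *m W w).
  by apply: bmvM => //; exact: (gen_mx_bmv mX (gen_mx_local_prod c t (H t))).
apply: (@le_trans _ _ (Ex P (fun w => (N%:R)^-1 *
    \sum_c enorm (local_prod c t (H t) w *m W w) ^+ 2))).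
  apply: le_Ex.
  - by apply: bmf_enorm_sqr; apply: bmvM => //; exact: (gen_mx_bmv mX (gen_mx_avg_prod t)).
  - by apply/bmfZ/bmf_sum => c; exact: bmf_enorm_sqr.
  - by move=> w; rewrite /avg_prod -avg_mulmx enorm_avg_sqr.
have bs c : bmf (fun w => enorm (local_prod c t (H t) w *m W w) ^+ 2).
  exact: bmf_enorm_sqr.
rewrite ExZ; last exact: bmf_sum.
rewrite Ex_sum// mulrC ler_pdivrMr//.
apply: (@le_trans _ _ (\sum_(c < N) ((1 - eta t * a) ^+ H t) ^+ 2 * msq P W)).
  apply: ler_sum => c _; rewrite -exprM mulnC exprM.
  exact: msq_local_prod (leqnn _) SI Sr gW.
by rewrite sumr_const card_ord mulr_natr.
Qed.

(** Minkowski's inequality over the agents, for the two square roots that make up [noise]. *)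
Lemma noise_sum : (N%:R)^-1 * \sum_c noise c ^+ 2 <=
  (sigma_eps pi A b thc + sigma_het pi A thc ths) ^+ 2.
Proof.
have i0 : 0 <= (N%:R)^-1 :> R by rewrite invr_ge0 ltW.
have tr0 c : 0 <= \tr (Sigmaeps pi A b thc c) by rewrite -msq_eps msq_ge0.
have op0 c : 0 <= opnorm (SigmaA pi A c) * enorm (thc c - ths) ^+ 2.
  by rewrite mulr_ge0 ?opnorm_ge0 ?sqr_ge0.
have s0 : 0 <= \sum_c noise c ^+ 2 by apply: sumr_ge0 => c _; exact: sqr_ge0.
rewrite -[leLHS]sqr_sqrtr ?mulr_ge0// lerXn2r ?nnegrE ?addr_ge0 ?sqrtr_ge0//.
rewrite /sigma_eps /sigma_het !sqrtrM// -mulrDr ler_wpM2l ?sqrtr_ge0//.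
have := sum_minkowski (fun c => Num.sqrt (\tr (Sigmaeps pi A b thc c)))
  (fun c => Num.sqrt (opnorm (SigmaA pi A c) * enorm (thc c - ths) ^+ 2)).
have -> : \sum_c Num.sqrt (\tr (Sigmaeps pi A b thc c)) ^+ 2 =
    \sum_c \tr (Sigmaeps pi A b thc c).
  by apply: eq_bigr => c _; rewrite sqr_sqrtr.
have -> : \sum_c Num.sqrt (opnorm (SigmaA pi A c) * enorm (thc c - ths) ^+ 2) ^+ 2 =
    \sum_c opnorm (SigmaA pi A c) * enorm (thc c - ths) ^+ 2.
  by apply: eq_bigr => c _; rewrite sqr_sqrtr.
exact.
Qed.

(** Distinct agents use disjoint samples, so only the diagonal of the double sum survives; the
    prefactor [N ^ -2] then leaves [1 / N] times an average. *)
Lemma msq_avg_fluct t : (1 <= t)%N ->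
  msq P (avg_fluct t) <= eta t ^+ 2 * (H t)%:R *
    ((sigma_eps pi A b thc + sigma_het pi A thc ths) ^+ 2 / N%:R).
Proof.
move=> t1; have bf c : bmv (fluct c t (H t)).
  exact: (gen_mx_bmv mX (gen_mx_fluct c t (H t))).
have i0 : 0 <= (N%:R)^-1 :> R by rewrite invr_ge0 ltW.
have bs : bmv (fun w => \sum_c fluct c t (H t) w).
  by move=> i j; under eq_fun do rewrite summxE; apply: bmf_sum => c; exact: bf.
rewrite /avg_fluct /avg msqZ// msqE.
under eq_fun do rewrite dot_suml.
rewrite Ex_sum; last by move=> c; apply: bmf_dot.
have E c : Ex P (fun w => dot (fluct c t (H t) w) (\sum_c' fluct c' t (H t) w)) =
    msq P (fluct c t (H t)).
  under eq_fun do rewrite dot_sumr.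
  rewrite Ex_sum; last by move=> c'; apply: bmf_dot.
  rewrite (bigD1 c)//= -msqE big1 ?addr0// => c' cc'.
  apply: (Ex_dot_indep0 mX hindep _ _ _ (gen_mx_fluct c t (H t)) (gen_mx_fluct c' t (H t))).
  - exact: local_sub_Idx.
  - exact: local_sub_Idx.
  - by move=> i [[ic _ _] [ic' _ _]]; move: cc'; rewrite -ic -ic' eqxx.
  - by rewrite mean_fluct.
under eq_bigr do rewrite E.
have le1 : \sum_c msq P (fluct c t (H t)) <=
    (H t)%:R * eta t ^+ 2 * \sum_c noise c ^+ 2.
  by rewrite mulr_sumr; apply: ler_sum => c _; rewrite -mulrA; exact: msq_fluct.
apply: (le_trans (ler_wpM2l (sqr_ge0 _) le1)).
have -> : (N%:R)^-1 ^+ 2 * ((H t)%:R * eta t ^+ 2 * \sum_c noise c ^+ 2) =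
  eta t ^+ 2 * (H t)%:R * (((N%:R)^-1 * \sum_c noise c ^+ 2) / N%:R) by ring.
apply: ler_wpM2l; first by rewrite mulr_ge0 ?sqr_ge0.
by rewrite ler_wpM2r// noise_sum.
Qed.

(** * Propagation of the error through the rounds *)

Fixpoint bias_part t w : 'cV[R]_d :=
  if t is t'.+1 then avg_prod t w *m bias_part t' w + avg_bias t else theta0 - ths.

Fixpoint fluct_part t w : 'cV[R]_d :=
  if t is t'.+1 then avg_prod t w *m fluct_part t' w + avg_fluct t w else 0.

(** Both parts are propagated by the same random [avg_prod], so [bias_part] is random too; they
    differ in their starting value and in what each round adds. *)
Lemma fedlsaE t w : fedlsa A b eta H theta0 Zs w t - ths = bias_part t w + fluct_part t w.
Proof.
elim: t => [|t IH]; first by rewrite addr0.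
rewrite /= -[X in _ - X](avg_cst ths) -/(avg _) -avgB.
transitivity (avg_prod t.+1 w *m (bias_part t w + fluct_part t w) + avg_bias t.+1 + avg_fluct t.+1 w).
  rewrite -IH /avg_prod /avg_bias /avg_fluct -avg_mulmx -!avgD.
  by congr avg; apply/funext => c; exact: local_iterE.
by rewrite mulmxDr -!addrA; congr (_ + _); rewrite addrCA.
Qed.

Lemma gen_mx_bias_part t : gsample (past_idx t) (bias_part t).
Proof.
elim: t => [|t IH]; first exact: gen_mx_cst.
apply: gen_mxD; last exact: gen_mx_cst.
apply: gen_mxM; first exact: gen_mx_sub (@round_sub_past t) (gen_mx_avg_prod t.+1).
exact: gen_mx_sub (@past_subS t) IH.
Qed.

Lemma gen_mx_fluct_part t : gsample (past_idx t) (fluct_part t).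
Proof.
elim: t => [|t IH]; first exact: gen_mx_cst.
apply: gen_mxD; last exact: gen_mx_sub (@round_sub_past t) (gen_mx_avg_fluct t.+1).
apply: gen_mxM; first exact: gen_mx_sub (@round_sub_past t) (gen_mx_avg_prod t.+1).
exact: gen_mx_sub (@past_subS t) IH.
Qed.

Lemma mean_fluct_part t : mean_mx P (fluct_part t) = 0.
Proof.
elim: t => [|t IH]; first exact: mean_mx_cst.
have [gG [gf gV]] := (gen_mx_avg_prod t.+1, (gen_mx_avg_fluct t.+1, gen_mx_fluct_part t)).
have [bG [bf bV]] := (gen_mx_bmv mX gG, (gen_mx_bmv mX gf, gen_mx_bmv mX gV)).
rewrite /= mean_mxD//; last exact: bmvM.
rewrite (mean_mulmx_indep mX hindep _ _ _ gG gV).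
- by rewrite IH mulmx0 add0r mean_avg_fluct.
- exact: round_sub_Idx.
- exact: past_sub_Idx.
- exact: round_past_disjoint.
Qed.

Lemma past_round_disjoint t : past_idx t `&` round_idx t.+1 `<=` set0.
Proof. by rewrite setIC; exact: round_past_disjoint. Qed.

(** The transposition argument again, one level up: [fluct_part t] is centred and depends on the
    past, while the transpose of [avg_prod] applied to [avg_fluct] only depends on the new round. *)
Lemma msq_fluct_partS t :
  msq P (fluct_part t.+1) <= ((1 - eta t.+1 * a) ^+ H t.+1) ^+ 2 * msq P (fluct_part t) +
    eta t.+1 ^+ 2 * (H t.+1)%:R *
    ((sigma_eps pi A b thc + sigma_het pi A thc ths) ^+ 2 / N%:R).
Proof.
have [gG [gf gV]] := (gen_mx_avg_prod t.+1, (gen_mx_avg_fluct t.+1, gen_mx_fluct_part t)).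
have [bG [bf bV]] := (gen_mx_bmv mX gG, (gen_mx_bmv mX gf, gen_mx_bmv mX gV)).
rewrite /= msqD//; last exact: bmvM.
have -> : Ex P (fun w => dot (avg_prod t.+1 w *m fluct_part t w) (avg_fluct t.+1 w)) = 0.
  under eq_fun do rewrite dot_tr.
  apply: (Ex_dot_indep0 mX hindep (@past_sub_Idx t) (@round_sub_Idx t.+1 isT)
    (@past_round_disjoint t) gV).
  - by apply: gen_mxM => //; exact: gen_mx_tr.
  - exact: mean_fluct_part.
rewrite mulr0 addr0; apply: lerD; last exact: msq_avg_fluct.
exact: msq_avg_prod (@past_sub_Idx t) (@past_round_disjoint t) gV.
Qed.

(** The added bias is not centred, hence Minkowski's inequality on L2 norms instead of
    orthogonality. *)
Lemma sqrt_msq_bias_partS t :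
  Num.sqrt (msq P (bias_part t.+1)) <=
  (1 - eta t.+1 * a) ^+ H t.+1 * Num.sqrt (msq P (bias_part t)) +
  eta t.+1 ^+ 2 * (H t.+1)%:R ^+ 2 * (zeta1 pi A thc ths * zeta2 pi A).
Proof.
have [gG gU] := (gen_mx_avg_prod t.+1, gen_mx_bias_part t).
have [bG bU] := (gen_mx_bmv mX gG, gen_mx_bmv mX gU).
have et := @heta t.+1 isT; have k0 := contraction_ge0 et.
apply: (le_trans (msq_minkowski P (bmvM bG bU) (bmv_cst (avg_bias t.+1)))).
apply: lerD; last first.
  rewrite msq_cst sqrtr_sqr ger0_norm ?enorm_ge0//.
  exact: enorm_avg_bias.
rewrite -[X in X * _]ger0_norm ?exprn_ge0// -sqrtr_sqr -sqrtrM ?sqr_ge0//.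
by apply: ler_wsqrtr; exact: msq_avg_prod (@past_sub_Idx t) (@past_round_disjoint t) gU.
Qed.

(** * Closed forms with exponential weights *)

Lemma contraction_expR t : (1 <= t)%N ->
  (1 - eta t * a) ^+ H t <= expR (- a * (eta t * (H t)%:R)).
Proof.
move=> t1; have et := heta t1.
have -> : - a * (eta t * (H t)%:R) = (H t)%:R * (- (eta t * a)) by ring.
rewrite expRM_natl lerXn2r ?nnegrE ?expR_ge0 ?contraction_ge0//.
exact: expR_ge1Dx.
Qed.

(** One more round multiplies all earlier weights by the same exponential, and the new term has an
    empty sum in its exponent. This matches the shape of the one-round recursions. *)
Lemma sum_expR_recr (c : R) (f g : nat -> R) t :
  \sum_(1 <= s < t.+2) (f s * expR (c * \sum_(s.+1 <= i < t.+2) g i)) =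
  expR (c * g t.+1) *
    \sum_(1 <= s < t.+1) (f s * expR (c * \sum_(s.+1 <= i < t.+1) g i)) + f t.+1.
Proof.
rewrite big_nat_recr//= [X in _ * expR (_ * X)]big_geq// mulr0 expR0 mulr1.
congr (_ + _); rewrite mulr_sumr; apply: eq_big_nat => s /andP[s1 st].
by rewrite big_nat_recr//= mulrDr expRD mulrA mulrC.
Qed.

Lemma sqrt_msq_bias_part t :
  Num.sqrt (msq P (bias_part t)) <=
  \prod_(1 <= s < t.+1) (1 - eta s * a) ^+ H s * enorm (theta0 - ths) +
  zeta1 pi A thc ths * zeta2 pi A *
    \sum_(1 <= s < t.+1) (eta s ^+ 2 * (H s)%:R ^+ 2 *
      expR (- a * \sum_(s.+1 <= i < t.+1) eta i * (H i)%:R)).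
Proof.
elim: t => [|t IH].
  rewrite !big_geq// mul1r mulr0 addr0 msq_cst sqrtr_sqr ger0_norm//.
  exact: enorm_ge0.
apply: (le_trans (sqrt_msq_bias_partS t)); have et := @heta t.+1 isT.
have k0 : 0 <= (1 - eta t.+1 * a) ^+ H t.+1 by rewrite exprn_ge0// contraction_ge0.
have z0 : 0 <= zeta1 pi A thc ths * zeta2 pi A by rewrite mulr_ge0 ?sqrtr_ge0.
rewrite sum_expR_recr big_nat_recr//=.
apply: (le_trans (lerD (ler_wpM2l k0 IH) (lexx _))).
set S := \sum_(1 <= s < t.+1) _; set p := \prod_(_ <= _ < _) _.
have S0 : 0 <= S.
  by apply: sumr_ge0 => s _; rewrite mulr_ge0 ?expR_ge0// mulr_ge0 ?sqr_ge0 ?ler0n.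
(* Only the accumulated sum [S] is bounded by the exponential; the term with the initial error keeps
   the exact contraction factor. *)
have := ler_wpM2r (mulr_ge0 z0 S0) (@contraction_expR t.+1 isT).
set z := zeta1 _ _ _ _ * zeta2 _ _; set k := _ ^+ H t.+1; set x := expR _.
set e := enorm _ => h.
have -> : k * (p * e + z * S) + eta t.+1 ^+ 2 * (H t.+1)%:R ^+ 2 * z =
  k * (z * S) + (p * k * e + z * (eta t.+1 ^+ 2 * (H t.+1)%:R ^+ 2)) by ring.
have -> : p * k * e + z * (x * S + eta t.+1 ^+ 2 * (H t.+1)%:R ^+ 2) =
  x * (z * S) + (p * k * e + z * (eta t.+1 ^+ 2 * (H t.+1)%:R ^+ 2)) by ring.
by rewrite lerD2r.
Qed.

Lemma msq_fluct_part t :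
  msq P (fluct_part t) <=
  (sigma_eps pi A b thc + sigma_het pi A thc ths) ^+ 2 / N%:R *
    \sum_(1 <= s < t.+1) (eta s ^+ 2 * (H s)%:R *
      expR (- (2 * a) * \sum_(s.+1 <= r < t.+1) eta r * (H r)%:R)).
Proof.
elim: t => [|t IH].
  by rewrite !big_geq// mulr0 msq_cst enorm0 expr0n.
apply: (le_trans (msq_fluct_partS t)); have et := @heta t.+1 isT.
have k0 : 0 <= (1 - eta t.+1 * a) ^+ H t.+1 by rewrite exprn_ge0// contraction_ge0.
rewrite sum_expR_recr mulrDr [X in _ + X]mulrC lerD2r.
apply: (le_trans (ler_wpM2l (sqr_ge0 _) IH)).
rewrite [leRHS]mulrCA; apply: ler_wpM2r.
  rewrite mulr_ge0 ?divr_ge0 ?sqr_ge0//.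
  by apply: sumr_ge0 => s _; rewrite mulr_ge0 ?expR_ge0// mulr_ge0 ?sqr_ge0 ?ler0n.
(* Second moments contract by the square of the factor, whence the rate [2 * a]. *)
have -> : - (2 * a) * (eta t.+1 * (H t.+1)%:R) =
    - a * (eta t.+1 * (H t.+1)%:R) + - a * (eta t.+1 * (H t.+1)%:R) by ring.
by rewrite expRD -expr2 lerXn2r ?nnegrE ?expR_ge0// contraction_expR.
Qed.

Lemma Lnorm_fedlsa_le t :
  (Lnorm P 2%:E (fun omega =>
      (enorm (fedlsa A b eta H theta0 Zs omega t - ths))%:E)
   <= (\prod_(1 <= s < t.+1) (1 - eta s * a) ^+ H s * enorm (theta0 - ths)
       + zeta1 pi A thc ths * zeta2 pi A *
         \sum_(1 <= s < t.+1) (eta s ^+ 2 * (H s)%:R ^+ 2 *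
            expR (- a * \sum_(s.+1 <= i < t.+1) eta i * (H i)%:R))
       + (sigma_eps pi A b thc + sigma_het pi A thc ths) / Num.sqrt (N%:R) *
         Num.sqrt (\sum_(1 <= s < t.+1) (eta s ^+ 2 * (H s)%:R *
            expR (- (2 * a) * \sum_(s.+1 <= r < t.+1) eta r * (H r)%:R))))%:E)%E.
Proof.
have bU := gen_mx_bmv mX (gen_mx_bias_part t); have bV := gen_mx_bmv mX (gen_mx_fluct_part t).
under eq_fun do rewrite fedlsaE.
rewrite Lnorm2_msq; last exact: bmvD.
rewrite lee_fin; apply: (le_trans (msq_minkowski P bU bV)).
apply: lerD; first exact: sqrt_msq_bias_part.
apply: (le_trans (ler_wsqrtr (msq_fluct_part t))).
have s0 : 0 <= sigma_eps pi A b thc + sigma_het pi A thc ths.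
  by rewrite addr_ge0 ?sqrtr_ge0.
rewrite sqrtrM; last by rewrite divr_ge0 ?sqr_ge0.
by rewrite sqrtrM ?sqr_ge0// sqrtr_sqr ger0_norm// sqrtrV.
Qed.

End Federated.

Unset Implicit Arguments.
Set Strict Implicit.

Theorem theorem1
  (R : realType) (dZ : measure_display) (Z : measurableType dZ)
  (dO : measure_display) (Omega : measurableType dO) (P : probability Omega R)
  (N d : nat) (hN : (0 < N)%N) (hd : (0 < d)%N)
  (pi : 'I_N -> probability Z R)
  (A : 'I_N -> Z -> 'M[R]_d) (b : 'I_N -> Z -> 'cV[R]_d)
  (mA : forall c i j, measurable_fun setT (fun z => A c z i j))
  (mb : forall c i j, measurable_fun setT (fun z => b c z i j))
  (ib : forall c i j, (pi c).-integrable setT (fun z => (b c z i j)%:E))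
  (ths : 'cV[R]_d) (thc : 'I_N -> 'cV[R]_d)
  (hths : Abar pi A *m ths = bbar pi b)
  (hthc : forall c, Abar_c pi A c *m thc c = bbar_c pi b c)
  (* Assumption A1(2) *)
  (a eta_inf : R) (ha : 0 < a) (heta_inf : 0 < eta_inf)
  (heta_a : eta_inf * a <= 1 / 2)
  (hurw : forall c, hurwitz (- Abar_c pi A c))
  (hA1 : forall (c : 'I_N) (eta : R) (u : 'cV[R]_d), 0 < eta < eta_inf ->
     (Lnorm (pi c) 2%:E (fun z => (enorm ((1%:M - eta *: A c z) *m u))%:E)
        <= ((1 - eta * a) * enorm u)%:E)%E)
  (* step sizes and local step numbers *)
  (eta : nat -> R) (H : nat -> nat)
  (heta : forall s, (1 <= s)%N -> 0 < eta s <= eta_inf)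
  (heta_noninc : forall s, (1 <= s)%N -> eta s.+1 <= eta s)
  (hH : forall s, (1 <= s)%N -> (1 <= H s)%N)
  (hH_nondec : forall s, (1 <= s)%N -> (H s <= H s.+1)%N)
  (* Assumption A2; Zs c t h = Z^c_{t,h} *)
  (Zs : 'I_N -> nat -> nat -> Omega -> Z)
  (mZs : forall c t h, measurable_fun setT (Zs c t h))
  (hlaw : forall c t h, (1 <= t)%N -> (1 <= h <= H t)%N ->
     forall B : set Z, measurable B -> P (Zs c t h @^-1` B) = pi c B)
  (hindep : mutually_independent P
     [set i : 'I_N * nat * nat | (1 <= i.1.2)%N /\ (1 <= i.2 <= H i.1.2)%N]
     (fun i => Zs i.1.1 i.1.2 i.2))
  (heps_bd : exists Ceps : R, forall c z, enorm (epsf pi A b thc c z) <= Ceps)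
  (hCA : exists CA : R, forall c z,
     opnorm (A c z) <= CA /\ opnorm (Atil pi A c z) <= CA)
  (theta0 : 'cV[R]_d) :
  forall t : nat, (1 <= t)%N ->
  (Lnorm P 2%:E (fun omega =>
      (enorm (fedlsa A b eta H theta0 Zs omega t - ths))%:E)
   <= (\prod_(1 <= s < t.+1) (1 - eta s * a) ^+ H s * enorm (theta0 - ths)
       + zeta1 pi A thc ths * zeta2 pi A *
         \sum_(1 <= s < t.+1) (eta s ^+ 2 * (H s)%:R ^+ 2 *
            expR (- a * \sum_(s.+1 <= i < t.+1) eta i * (H i)%:R))
       + (sigma_eps pi A b thc + 2 * sigma_het pi A thc ths)
           / Num.sqrt (N%:R) *
         Num.sqrt (\sum_(1 <= s < t.+1) (eta s ^+ 2 * (H s)%:R *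
            expR (- (2 * a) * \sum_(s.+1 <= r < t.+1) eta r * (H r)%:R)))
       + Num.sqrt (4 * sigma_A pi A ^+ 2 * zeta1 pi A thc ths ^+ 2
                     * zeta2 pi A ^+ 2 / (N%:R * a * expR 1)) *
         Num.sqrt (\sum_(1 <= s < t.+1) (eta s ^+ 5 * (H s)%:R ^+ 4 *
            expR (- a * \sum_(s.+1 <= r < t.+1) eta r * (H r)%:R))))%:E)%E.
Proof.
move=> t _.
apply: (le_trans (Lnorm_fedlsa_le hN mA mb hths hthc ha heta_inf heta_a hA1 heta
  mZs hlaw hindep heps_bd hCA theta0 t)).
have h0 : 0 <= sigma_het pi A thc ths by exact: sqrtr_ge0.
(* The bound of [Lnorm_fedlsa_le] is padded by zero, which is compared with the nonnegative last
   summand; the rest follows from [sigma_het <= 2 * sigma_het]. *)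
rewrite lee_fin -[leLHS]addr0; apply: lerD; last first.
  by rewrite mulr_ge0 ?sqrtr_ge0.
rewrite lerD2l !ler_wpM2r ?invr_ge0 ?sqrtr_ge0//.
by rewrite lerD2l ler_peMl// ler1n.
Qed.
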